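(* Let $G$ be a finite connected simple cubic graph that has a $6$-cycle double cover. Then $G$ has a Hamiltonian cycle.
   Context: All graphs are finite, connected, undirected, with no multiple edges or self-loops. A cubic graph is a $3$-regular graph. A cycle double cover (CDC) of a graph $G$ is a collection of cycles of $G$ such that every edge of $G$ belongs to exactly two of the cycles in the collection. A $6$-cycle double cover ($6$-CDC) is a CDC in which every cycle has length $6$. *)

(* Defs.v *)
From mathcomp Require Import all_boot.

Set Implicit Arguments.
Unset Strict Implicit.
Unset Printing Implicit Defensive.

(* A graph is given by its adjacency relation e on a finite vertex type T;   *)
(* it is a simple undirected graph when e is symmetric and irreflexive.      *)
Definition simple_graph (T : finType) (e : rel T) : Prop :=
  symmetric e /\ irreflexive e.

(* The graph with no vertices does not count as connected. *)
Definition connected_graph (T : finType) (e : rel T) : Prop :=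
  0 < #|T| /\ forall x y : T, connect e x y.

Definition cubic_graph (T : finType) (e : rel T) : Prop :=
  forall x : T, #|[set y | e x y]| = 3.

(* A cycle is presented by the cyclic sequence of its distinct vertices. The *)
(* length condition excludes the degenerate ucycles [::] and [:: x; y], the  *)
(* latter of which traverses a single edge back and forth.                   *)
Definition graph_cycle (T : finType) (e : rel T) (c : seq T) : Prop :=
  ucycle e c /\ 2 < size c.

(* The unordered pair {x, y} is an edge of the cycle c. *)
Definition edge_of_cycle (T : finType) (x y : T) (c : seq T) : bool :=
  [&& x \in c, y \in c & (next c x == y) || (next c y == x)].

(* The collection is a sequence of cycles, so that a cycle may occur in it   *)
(* several times and is then counted with multiplicity.                      *)
Definition cycle_double_cover
    (T : finType) (e : rel T) (C : seq (seq T)) : Prop :=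
  (forall c, c \in C -> graph_cycle e c) /\
  (forall x y : T, e x y -> count (edge_of_cycle x y) C = 2).

Definition six_cycle_double_cover
    (T : finType) (e : rel T) (C : seq (seq T)) : Prop :=
  cycle_double_cover e C /\ forall c, c \in C -> size c = 6.

Definition hamiltonian_cycle (T : finType) (e : rel T) (c : seq T) : Prop :=
  graph_cycle e c /\ forall x : T, x \in c.

(* Main.v *)
Require Import Defs.
From mathcomp Require Import all_boot.
From mathcomp Require Import zify.

Set Implicit Arguments.
Unset Strict Implicit.
Unset Printing Implicit Defensive.

(* By the double cover, each corner y - x - z lies on exactly one hexagon, so *)
(* the hexagons tile a torus or a Klein bottle, covered by the honeycomb of   *)
(* the plane.  Frames (a vertex with its three edges in order) can be         *)
(* transported along edges; no rotation of order three occurs as holonomy,    *)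
(* and therefore some parallel class of edges (the X-edges) is globally       *)
(* defined.  Deleting it leaves disjoint cycles, the columns, and each        *)
(* hexagon meets two neighbouring columns in two edges each.                  *)
(*                                                                            *)
(* A Hamiltonian cycle is found as a connected 2-factor: the symmetric        *)
(* difference of the columns with closed curves ("strands") which cross each  *)
(* column along one edge and alternate with X-edges.  When the number m of    *)
(* columns is even, a single strand that goes up and down alternately works,  *)
(* as do simple explicit strands on the Klein bottle.  If m is odd and the    *)
(* length 2h of the columns is divisible by 4, another class of edges has an  *)
(* even number of columns.  If m and h are odd, parallel strands that follow  *)
(* one closed curve leave an odd number d of cycles, and rerouting (d - 1)/2  *)
(* strands around neighbouring hexagons merges all of them; the curve itself  *)
(* is Hamiltonian when its strands leave no room for this.                    *)

(** * Connected 2-factors *)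

(** Each pair of edges at a vertex lies on exactly one cycle of the cover ([hexagonal_of_cdc]), so
    the cycles are the faces of a hexagonal surface. Frames are transported along edges. Holonomy of
    order three is impossible, even up to a half-turn ([no_par_rotation]), because its centre would
    be a vertex or a face. Hence at most one of the three kinds of reflection occurs, and one class
    of edges can consistently be called X-edges ([ex_no_slant]).

    If no transported frame returns upside down, the frames give a section and the graph becomes a
    [honeycomb] ([hamiltonian_of_section]). Otherwise a glide reverses the columns, and an explicit
    cycle runs through them one after another ([hamiltonian_of_reflected]).

    On a honeycomb a connected 2-factor suffices ([hamiltonian_of_two_factor]); candidates come from
    deleting column edges and adding the X-edges at their ends ([hamiltonian_of_strands]).
    [hamiltonian_of_honeycomb] distinguishes an odd column ([hamiltonian_of_odd_column]), an even
    number of columns ([hamiltonian_of_even_width]), column length divisible by 4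
    ([hamiltonian_of_even_height], the previous argument in another edge direction), a single
    column, and the odd torus ([hamiltonian_of_odd_torus]), whose combinatorial core is
    [strips_connected]. *)

Lemma cycle_mkseq (T : Type) (e : rel T) (v : nat -> T) n :
  (forall i, i.+1 < n -> e (v i) (v i.+1)) -> e (v n.-1) (v 0) ->
  cycle e (mkseq v n).
Proof.
case: n => // n ev e0; rewrite /mkseq /= rcons_path.
have last_v i k : last (v i) [seq v j | j <- iota i.+1 k] = v (i + k).
  by elim: k i => [|k IH] i /=; rewrite ?addn0 // IH addSnnS.
rewrite last_v add0n e0 andbT.
have: forall i, i < n -> e (v (0 + i)) (v (0 + i).+1) by move=> i; exact: ev.
elim: n 0 {ev e0} => //= n IH k ek; rewrite -{1}[k]addn0 -{2}[k]addn0 ek //=.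
by apply: IH => i li; rewrite addSnnS; exact: ek.
Qed.

Section TwoFactor.

Variables (T : finType) (e F : rel T).
Hypotheses (F_sym : symmetric F) (F_irr : irreflexive F) (F_sub : subrel F e).
Hypothesis F_deg : forall x, #|[set y | F x y]| = 2.
Hypothesis F_conn : forall x y, connect F x y.
Hypothesis T_gt0 : 0 < #|T|.

Lemma other_neighbour_ex (xy : T * T) : exists z,
  F xy.1 xy.2 -> [/\ F xy.1 z, z != xy.2 &
    forall w, F xy.1 w -> w = xy.2 \/ w = z].
Proof.
case: xy => x y /=; case Fxy: (F x y); last by exists x.
have /eqP/cards2P [a [b [nab eab]]] := F_deg x.
have: y \in [set a; b] by rewrite -eab inE.
have mem w : F x w -> w \in [set a; b] by rewrite -eab inE.
have Fa : F x a by have: a \in [set a; b];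
  [rewrite !inE eqxx | rewrite -eab inE].
have Fb : F x b
  by have: b \in [set a; b]; [rewrite !inE eqxx orbT | rewrite -eab inE].
rewrite !inE => /orP[] /eqP ->.
  exists b => _; split; rewrite ?(eq_sym b) // => w /mem.
  by rewrite !inE => /orP[] /eqP ->; [left | right].
exists a => _; split=> // w /mem.
by rewrite !inE => /orP[] /eqP ->; [right | left].
Qed.

(** Walk along [F] without turning back. The first repeated vertex must be the start, since any
    other would acquire a third [F]-neighbour; the closed walk is then stable under [F], and
    connectedness makes it spanning. *)
Lemma hamiltonian_of_two_factor : exists c, hamiltonian_cycle e c.
Proof.
have [other otherP] := fin_all_exists other_neighbour_ex.
have [x0 _] : exists x0 : T, x0 \in T by apply/card_gt0P.
have [y0 Fxy0] : exists y0, F x0 y0.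
  have /eqP/cards2P [a [b [_ eab]]] := F_deg x0.
  by exists a; have: a \in [set a; b]; [rewrite !inE eqxx | rewrite -eab inE].
pose step xy : T * T := (xy.2, other (xy.2, xy.1)).
pose v n := (iter n step (x0, y0)).1.
have vSS n : v n.+2 = other (v n.+1, v n) by [].
have Fv n : F (v n) (v n.+1).
  elim: n => [|n IH]; first by [].
  rewrite F_sym in IH.
  by have [] := otherP (v n.+1, v n) IH.
have v2 n : v n.+2 != v n.
  by rewrite vSS; have := Fv n; rewrite F_sym => /(otherP (_, _)) [].
have nbr n w : F (v n.+1) w -> w = v n \/ w = v n.+2.
  move=> Fw; rewrite vSS; have := Fv n; rewrite F_sym => /(otherP (_, _)) [_ _].
  exact.
have ex_rep : exists n, ~~ uniq (mkseq v n).
  exists #|T|.+1; apply/negP => /card_uniqP; rewrite size_mkseq => c.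
  by have := max_card (mem (mkseq v #|T|.+1)); rewrite c ltnn.
case: (ex_minnP ex_rep) => {ex_rep} [[|n] // nu nmin].
have un : uniq (mkseq v n) by apply: contraT => /nmin; rewrite ltnn.
have inj i j : i < n -> j < n -> v i = v j -> i = j.
  by move=> li lj; apply: (mkseq_uniqP v n un); rewrite !inE.
move: nu; rewrite /mkseq -addn1 iotaD map_cat cats1 rcons_uniq add0n negb_and.
rewrite [uniq _]un orbF negbK => /mapP [i];
  rewrite mem_iota /= add0n => lti vni.
(* Returning to [v i.+1] is impossible: its neighbour [v n.-1] would have to be [v i] or
   [v i.+2]. *)
case: i => [|i] in lti vni *; last first.
  have := Fv n.-1; rewrite (ltn_predK lti) vni F_sym => /nbr [] E.
    by have := inj _ _ _ _ E; lia.
  have [ltn1|gen1] := ltnP i.+2 n.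
    have /esym/eqP : n.-1 = i.+2 by apply: inj E; lia.
    rewrite -(eqn_add2r 1) !addn1 (ltn_predK lti) => /eqP En.
    by have := v2 i.+1; rewrite En vni eqxx.
  have En : n = i.+2 by lia.
  by have := Fv i.+1; rewrite -En vni F_irr.
have n3 : 2 < n.
  case: n => [|[|[|n]]] // in un nmin inj vni lti *.
    by have := Fv 0; rewrite -vni F_irr.
  by have := v2 0; rewrite vni eqxx.
exists (mkseq v n).
have closed i w : i < n -> F (v i) w -> exists2 j, j < n & w = v j.
  case: i => [|i] lin.
    have F0 : F (v 0) (v n.-1) by rewrite F_sym -[in X in F _ X]vni;
      have := Fv n.-1; rewrite (ltn_predK lti).
    case: (otherP (v 0, v 1) (Fv 0)) => /= _ _ nb.
    have En : v n.-1 = other (v 0, v 1).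
      case: (nb _ F0) => // E.
      by have := inj _ _ _ _ E; lia.
    by move=> /nb [->|->]; [exists 1 => //; lia | exists n.-1;
      rewrite -?En //; lia].
  case/nbr=> ->; first by exists i => //; lia.
  have [lt|ge] := ltnP i.+2 n; first by exists i.+2.
  have -> : i.+2 = n by lia.
  by exists 0 => //; lia.
split; last first.
  move=> x; have : connect F (v 0) x by exact: F_conn.
  have mem y : reflect (exists2 j, j < n & y = v j) (y \in mkseq v n).
    apply: (iffP mapP) => [] [j]; first by rewrite mem_iota; exists j.
    by exists j; rewrite ?mem_iota.
  case/connectP => p; elim: p 0 lti {vni} => [|y p IH] i lin /=.
    by move=> _ ->; apply/mem; exists i.
  by case/andP=> /(closed _ _ lin) [j lj ->]; apply: IH.
split; last by rewrite size_mkseq.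
apply/andP; split=> //.
apply: cycle_mkseq => [i _|]; first exact: F_sub.
by apply: F_sub; rewrite -[in v 0]vni; have := Fv n.-1; rewrite (ltn_predK lti).
Qed.

End TwoFactor.

(** * Honeycombs and strands *)

(** The factorial of [#|T|] is a common period of all permutations of [T]; it allows backward steps
    to be replaced by forward ones. *)
Lemma iter_card_fact (T : finType) (f : T -> T) (x : T) :
  injective f -> iter #|T|`! f x = x.
Proof.
move=> injf; have /dvdnP [k ->] : order f x %| #|T|`!.
  by apply: dvdn_fact; rewrite order_gt0 max_card.
rewrite iterM; elim: k => //= k ->; exact: iter_order.
Qed.

Lemma iter_inj (A : Type) (f : A -> A) n : injective f -> injective (iter n f).
Proof. by move=> injf; elim: n => //= n IH x y /injf /IH. Qed.

Lemma iter_order_dvdn (T : finType) (f : T -> T) (x : T) n :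
  injective f -> iter n f x = x -> order f x %| n.
Proof.
move=> injf; rewrite {1}(divn_eq n (order f x)) addnC iterD iterM.
have -> k : iter k (iter (order f x) f) x = x.
  by elim: k => //= k ->; exact: iter_order.
move=> E; rewrite /dvdn; apply/eqP.
have lt : n %% order f x < order f x by rewrite ltn_mod order_gt0.
have := findex_iter lt; rewrite E.
by rewrite -[x in findex f x x]/(iter 0 f x) findex_iter // order_gt0.
Qed.

Lemma iter_eq_order_dvdn (T : finType) (f : T -> T) (x : T) m n :
  injective f -> iter m f x = iter n f x -> m = n %[mod order f x].
Proof.
move=> injf; wlog le : m n / m <= n => [H E|].
  by case/orP: (leq_total m n) => le; [|symmetry]; apply: H.
rewrite -{1}(subnKC le) iterD => /(iter_inj injf) /esym /(iter_order_dvdn injf).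
by move=> dv; apply/eqP; rewrite eq_sym eqn_mod_dvd.
Qed.

(* The orbits of U are the columns; X crosses to a neighbouring column, and     *)
(* hc_comm says that U, U, X, U', U', X runs around a hexagon.                  *)
Record honeycomb (T : finType) (U U' X : T -> T) : Prop := Honeycomb {
  hc_UK : cancel U U';
  hc_U'K : cancel U' U;
  hc_XK : involutive X;
  hc_comm : forall v, U (U (X v)) = X (U (U v));
  hc_free : forall v, uniq [:: v; X v; U v; U' v];
  hc_trans : forall v (S : T -> Prop), S v ->
    (forall u, S u -> S (U u)) -> (forall u, S u -> S (X u)) ->
    forall u, S u }.

Definition honeycomb_adj (T : finType) (U U' X : T -> T) : rel T :=
  fun v w => [|| w == X v, w == U v | w == U' v].

Section Strands.

Variables (T : finType) (U U' X : T -> T).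
Hypothesis hc : honeycomb U U' X.
Variable P : pred T.

Let UK := hc_UK hc.
Let U'K := hc_U'K hc.
Let XK := hc_XK hc.

(* The vertices of P are the lower ends of the deleted column edges {v, U v};  *)
(* the edges {v, X v} are kept exactly at the ends of deleted column edges.    *)
Definition opened : rel T := fun v w =>
  [|| (w == X v) && (P v || P (U' v)), (w == U v) && ~~ P v
    | (w == U' v) && ~~ P (U' v)].

Hypothesis P_disj : forall v, P v -> ~~ P (U v).
Hypothesis P_X : forall v, P v || P (U' v) -> P (X v) || P (U' (X v)).

Lemma opened_sym : symmetric opened.
Proof.
suff H v w : opened v w -> opened w v by move=> v w; apply/idP/idP; apply: H.
case/or3P=> /andP [/eqP -> H]; apply/or3P.
- by apply: Or31; rewrite XK eqxx P_X.
- by apply: Or33; rewrite UK eqxx H.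
- by apply: Or32; rewrite U'K eqxx H.
Qed.

Lemma opened_up v : ~~ P v -> connect opened v (U v).
Proof. by move=> nP; apply: connect1; rewrite /opened eqxx nP orbT. Qed.

Lemma opened_cross v : P v || P (U' v) -> connect opened v (X v).
Proof. by move=> H; apply: connect1; rewrite /opened eqxx H. Qed.

Lemma opened_crossU v : P v -> connect opened (U v) (X (U v)).
Proof. by move=> H; apply: opened_cross; rewrite UK H orbT. Qed.

Lemma opened_climb v n :
  (forall i, i < n -> ~~ P (iter i U v)) -> connect opened v (iter n U v).
Proof.
elim: n => [|n IH] H //=; apply: connect_trans (IH _) (opened_up (H _ _)) => //.
by move=> i li; apply: H; apply: ltnW.
Qed.

Lemma opened_csym : connect_sym opened.
Proof. by apply: sym_connect_sym; exact: opened_sym. Qed.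

Lemma opened_reach v n : P (iter n U v) -> exists2 q, P q & connect opened v q.
Proof.
move=> Pn; have ex : exists i, P (iter i U v) by exists n.
case: (ex_minnP ex) => i Pi imin; exists (iter i U v) => //.
apply: opened_climb => j lj; apply/negP => /imin; lia.
Qed.

(** By [P_disj], an end of a deleted edge loses just one column edge and gains its X-edge, so all
    degrees are two and only connectedness remains to be checked. *)
Lemma hamiltonian_of_strands :
  0 < #|T| -> (forall v w, connect opened v w) ->
  exists c, hamiltonian_cycle (honeycomb_adj U U' X) c.
Proof.
move=> T0 conn; apply: (@hamiltonian_of_two_factor _ _ opened) => //.
- exact: opened_sym.
- move=> v; have := hc_free hc v; rewrite /= !inE !negb_or.
  by rewrite /opened => /andP[/and3P[/negPf-> /negPf-> /negPf->]].
- move=> v w; rewrite /honeycomb_adj.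
  by case/or3P=> /andP [-> _]; rewrite ?orbT.
move=> v; have := hc_free hc v; rewrite /= !inE !negb_or.
case/and4P=> _ /andP [XU XU'] UU' _.
have nPU' : P v -> P (U' v) = false.
  by move=> Pv; apply/negP => /P_disj; rewrite U'K Pv.
apply/eqP/cards2P; case Pv: (P v); last case PU: (P (U' v)).
- exists (X v), (U' v); split=> //.
  by apply/setP => w; rewrite !inE /opened Pv nPU' //= andbT andbF andbT.
- exists (X v), (U v); split=> //.
  by apply/setP => w; rewrite !inE /opened Pv PU //= !andbT andbF orbF.
- exists (U v), (U' v); split=> //.
  by apply/setP => w; rewrite !inE /opened Pv PU //= !andbT andbF.
Qed.

End Strands.


Lemma connect_ind (T : finType) (r : rel T) (S : T -> Prop) x y :
  S x -> (forall u v, S u -> r u v -> S v) -> connect r x y -> S y.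
Proof.
move=> Sx Sr /connectP [p]; elim: p x Sx => [|z p IH] x Sx /=.
  by move=> _ ->.
by case/andP=> /(Sr _ _ Sx) Sz; exact: IH.
Qed.

(** * Translations of the honeycomb *)

Section Algebra.

Variables (T : finType) (U U' X : T -> T).
Hypothesis hc : honeycomb U U' X.

Lemma U_inj : injective U. Proof. exact: can_inj (hc_UK hc). Qed.
Lemma X_inj : injective X. Proof. exact: can_inj (hc_XK hc). Qed.

(** In the covering honeycomb this is the translation to the next column at even heights; at odd
    heights it goes back by one column. *)
Definition shift v := X (U v).

Lemma shift_inj : injective shift. Proof. by move=> u v /X_inj /U_inj. Qed.

Lemma iterU_X n v : iter n.*2 U (X v) = X (iter n.*2 U v).
Proof. by elim: n => //= n ->; rewrite (hc_comm hc). Qed.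

Lemma iterU_shift n i v :
  iter n.*2 U (iter i shift v) = iter i shift (iter n.*2 U v).
Proof.
elim: i => //= i <-; rewrite /shift iterU_X; congr X.
by rewrite -iterS iterSr.
Qed.

(** Consecutive vertices of a column have their X-edges on opposite sides, so after one step up
    [shift] moves back. The identity makes a reflection visible as an odd power of [U]. *)
Lemma shift_U_shift i v : iter i shift (U (iter i shift v)) = iter i.*2.+1 U v.
Proof.
elim: i v => // i IH v; rewrite iterS [iter i.+1 shift v]iterSr IH.
rewrite iterS (iterU_shift i 1) doubleS /= /shift.
by rewrite -(hc_comm hc) (hc_XK hc).
Qed.

End Algebra.

(** * A single alternating strand *)

Section AlternatingStrand.

Variables (T : finType) (U U' X : T -> T).
Hypothesis hc : honeycomb U U' X.
Variable kappa : T -> bool.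
Hypothesis kappa_U : forall v, kappa (U v) = ~~ kappa v.
Hypothesis kappa_X : forall v, kappa (X v) = kappa v.

Let UK := hc_UK hc.
Let U'K := hc_U'K hc.
Let XK := hc_XK hc.
Let Y v := U' (X (U v)).

Let kappa_iter n v : kappa (iter n U v) = odd n (+) kappa v.
Proof. by elim: n => //= n IH; rewrite kappa_U IH; case: (odd n);
  case: kappa. Qed.

Let iterU_U' n v : iter n U (U' v) = U' (iter n U v).
Proof. by elim: n => //= n ->; rewrite U'K UK. Qed.

Let iterU_Y n v : iter n.*2 U (Y v) = Y (iter n.*2 U v).
Proof. by rewrite /Y iterU_U' (iterU_X hc) -iterSr. Qed.

(** Think of the X-edges as horizontal and of [kappa] as the parity of the height. The strand
    through [p] runs horizontally, going up and down one edge in turn, and meets each column at even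
    distances. All gaps between crossings are equal, which lets neighbouring arcs be linked all
    along the strand. *)
Lemma hamiltonian_of_alternation (p : T) :
  exists c, hamiltonian_cycle (honeycomb_adj U U' X) c.
Proof.
(* [X] continues the strand from the lower end of a deleted edge and [Y] from the upper end, since
   [U (Y q) = X (U q)]. *)
pose kr : rel T := fun v w => (w == X v) || (w == Y v).
pose P := connect kr p.
have YK : involutive Y by move=> v; rewrite /Y U'K XK UK.
have PX q : P q -> P (X q).
  by move=> Pq; apply: connect_trans Pq (connect1 _); rewrite /kr eqxx.
have PY q : P q -> P (Y q).
  by move=> Pq; apply: connect_trans Pq (connect1 _); rewrite /kr eqxx orbT.
have kY v : kappa (Y v) = kappa v.
  have := kappa_U (Y v); rewrite /Y U'K kappa_X kappa_U.
  by case: (kappa v); case: (kappa _).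
have kP q : P q -> kappa q = kappa p.
  apply: (connect_ind (S := fun q => kappa q = kappa p)) => // u v <-.
  by case/orP=> /eqP ->; rewrite ?kappa_X ?kY.
have oddP n q : P q -> odd n -> ~~ P (iter n U q).
  move=> Pq on; apply/negP => /kP; rewrite kappa_iter on (kP _ Pq).
  by case: (kappa p).
have P_disj v : P v -> ~~ P (U v) by move=> Pv; exact: (oddP 1).
have P_X v : P v || P (U' v) -> P (X v) || P (U' (X v)).
  case/orP=> [/PX -> //|/PY]; rewrite /Y U'K => ->; exact: orbT.
(* [s] is the distance from [p] to the next crossing in its column. It is even by [kappa], hence
   commutes with [X] and [Y] and is the gap at every crossing. *)
have ex_s : exists s, (0 < s) && P (iter s U p).
  by exists #|T|`!; rewrite fact_gt0 (iter_card_fact _ (U_inj hc));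
    apply: connect0.
case: (ex_minnP ex_s) => s /andP [s0 Ps] smin {ex_s}.
have es : s = s./2.*2.
  rewrite -[LHS]odd_double_half; case: (boolP (odd s)) => // os.
  by have := oddP _ _ (connect0 kr p) os; rewrite Ps.
pose A q := P (iter s U q) /\ forall j, 0 < j < s -> ~~ P (iter j U q).
have Aall q : P q -> P q /\ A q.
  apply: (connect_ind (S := fun q => P q /\ A q)).
    split; first exact: connect0.
    split=> // j /andP [j0 js]; apply/negP => Pj.
    by have := smin j; rewrite j0 Pj => /(_ isT); lia.
  move=> u v [Pu [Pus Pui]] ruv.
  have Pv : P v by apply: connect_trans Pu (connect1 _).
  split=> //; split.
    rewrite es; case/orP: ruv => /eqP ->.
      by rewrite (iterU_X hc); apply: PX; rewrite -es.
    by rewrite iterU_Y; apply: PY; rewrite -es.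
  move=> j lj; case: (boolP (odd j)) => [oj|ej]; first exact: oddP.
  apply/negP; rewrite -(odd_double_half j) (negPf ej) add0n.
  have {lj} := Pui _ lj; rewrite -{1}(odd_double_half j) (negPf ej) add0n.
  move=> /negP nP Pv'; apply: nP; case/orP: ruv Pv' => /eqP ->.
    by rewrite (iterU_X hc) => /PX; rewrite XK.
  by rewrite iterU_Y => /PY; rewrite YK.
have Ps' q : P q -> P (iter s U q) by case/Aall => _ [].
set C := connect (opened U U' X P).
have Csym : connect_sym (opened U U' X P) by apply: (opened_csym hc).
have CU q : P q -> C (U q) (iter s U q).
  move=> Pq; have [_ [_ nP]] := Aall _ Pq.
  have -> : iter s U q = iter s.-1 U (U q) by rewrite -iterSr prednK.
  by apply: opened_climb => i li; rewrite -iterSr; apply: nP; lia.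
(* Write [q = iter s U q']: the arc below [q] starts at [U q'], whose X-edge leads to [U (Y q')],
   and the arc starting there ends at [Y q]. *)
have CY q : P q -> C q (Y q).
  move=> Pq.
  have [q' Pq' ->] : exists2 q', P q' & q = iter s U q'.
    exists (iter #|T|`!.-1 (iter s U) q).
      by elim: _.-1 => //= n /Ps'.
    rewrite -iterS prednK ?fact_gt0 // iter_card_fact //.
    by apply: iter_inj; exact: U_inj hc.
  rewrite {2}es -iterU_Y -es.
  apply: (connect_trans (y := U q')); first by rewrite Csym; apply: CU.
  apply: connect_trans (CU _ (PY _ Pq')).
  rewrite [U (Y q')]U'K; exact: opened_crossU.
have CP q : P q -> C p q.
  move=> Pq; apply: proj2 (_ : P q /\ C p q); move: Pq.
  apply: (connect_ind (S := fun q => P q /\ C p q)).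
    by split; exact: connect0.
  move=> u v [Pu Cu] ruv; split; first by apply: connect_trans Pu (connect1 _).
  apply: connect_trans Cu _; case/orP: ruv => /eqP ->; last exact: CY.
  by apply: opened_cross; rewrite Pu.
have Cp v : C p v.
  have [n Pn] : exists n, P (iter n U v).
    apply: (hc_trans hc (v := p) (S := fun v => exists n, P (iter n U v))).
    - by exists 0; exact: connect0.
    - move=> u [n /Ps']; rewrite -iterD => Pn; exists (s + n).-1.
      by rewrite -iterSr prednK // ltn_addr.
    - move=> u [n Pn]; exists n; move: Pn; rewrite -(odd_double_half n).
      case: (odd n); rewrite ?add0n ?add1n ?iterS /=.
        by move/PY; rewrite /Y -(hc_comm hc) UK -(iterU_X hc).
      by move/PX; rewrite -(iterU_X hc).
  have [q Pq Cq] := opened_reach U' X Pn.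
  by rewrite /C Csym; apply: connect_trans Cq _; rewrite Csym; exact: CP.
apply: (hamiltonian_of_strands hc P_disj P_X).
  by apply/card_gt0P; exists p.
by move=> v w; apply: connect_trans (Cp w); rewrite Csym; exact: Cp.
Qed.

End AlternatingStrand.

(* A column of odd length is the core of a Moebius band: this is the case of  *)
(* a Klein bottle whose glide axis runs along the columns.                    *)
Section OddColumn.

Variables (T : finType) (U U' X : T -> T).
Hypothesis hc : honeycomb U U' X.
Variables (v0 : T) (h H M : nat).
Hypotheses (order_v0 : order U v0 = h) (eh : h = H.*2.+1).

Let UK := hc_UK hc.
Let U'K := hc_U'K hc.
Let XK := hc_XK hc.
Let Uinj := U_inj hc.
Let sh := shift U X.
Let p i := iter i sh v0.

Hypotheses (M_gt0 : 0 < M) (odd_M : odd (order U (p M))).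
Hypothesis even_inner : forall i, 0 < i < M -> ~~ odd (order U (p i)).

Let odd_h : odd h.
Proof. by rewrite eh /= odd_double. Qed.

Let hK : iter h U v0 = v0.
Proof. by rewrite -order_v0; exact: iter_order. Qed.

Let neqU v : U v <> v.
Proof. by move=> E; have := hc_free hc v; rewrite /= !inE E eqxx !orbT. Qed.

Let neqX v : X v <> v.
Proof. by move=> E; have := hc_free hc v; rewrite /= !inE E eqxx. Qed.

Let H_gt0 : 0 < H.
Proof. by case E: H => //; move: hK; rewrite eh E /= => /neqU. Qed.

Let U2h v : iter h.*2 U v = v.
Proof.
apply: (hc_trans hc (v := v0) (S := fun v => iter h.*2 U v = v)).
- by rewrite -addnn iterD !hK.
- by move=> u; rewrite -iterSr /= => ->.
- by move=> u; rewrite (iterU_X hc) => ->.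
Qed.

Let even_period n v : iter n.*2 U v = v -> h %| n.
Proof.
move: n; apply: (hc_trans hc (v := v0)
  (S := fun v => forall n, iter n.*2 U v = v -> h %| n)) => [n|u IH n|u IH n].
- move=> /(iter_order_dvdn Uinj); rewrite order_v0 -muln2 Gauss_dvdl //.
  by rewrite coprimen2.
- by rewrite -iterSr iterS => /Uinj /IH.
- by rewrite (iterU_X hc) => /(X_inj hc) /IH.
Qed.

Let even_eq n m v : iter n.*2 U v = iter m.*2 U v -> n = m %[mod h].
Proof.
wlog le : m n / m <= n => [W E|].
  by case/orP: (leq_total m n) => le; [|symmetry]; apply: W.
rewrite -{1}(subnKC le) doubleD iterD => /(iter_inj Uinj) /even_period dv.
by apply/eqP; rewrite eqn_mod_dvd.
Qed.

Let even_mod n v : iter n.*2 U v = iter (n %% h).*2 U v.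
Proof.
rewrite {1}(divn_eq n h) addnC doubleD iterD doubleMr iterM.
by congr iter; elim: (n %/ h) => //= k ->.
Qed.

(** Modulo the odd number [h], doubling has the inverse [H.+1]. *)
Let mod_halve a c : a.*2 = c.*2 %[mod h] -> a = c %[mod h].
Proof.
have E k : k %% h = ((k.*2 %% h) * H.+1) %% h.
  by rewrite modnMml (_ : k.*2 * H.+1 = k * h + k) ?modnMDl // eh; lia.
by move=> Eac; rewrite (E a) (E c) Eac.
Qed.

Let odd_period v : odd (order U v) -> iter h U v = v.
Proof.
move=> ov; have : order U v %| h.
  have := iter_order_dvdn Uinj (U2h v); rewrite -muln2 Gauss_dvdl //.
  by rewrite coprimen2.
case/dvdnP=> k ->; rewrite iterM; elim: k => //= k ->; exact: iter_order.
Qed.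

Let hKM : iter h U (p M) = p M.
Proof. exact: odd_period. Qed.

Let pD i j : iter i sh (p j) = p (i + j).
Proof. by rewrite /p iterD. Qed.

Let shift_h l : iter l sh (iter h U (p l)) = iter l.*2 U v0.
Proof.
rewrite eh iterSr -(iterU_shift hc) (shift_U_shift hc) -iterD addnS addnC.
by rewrite -addnS -eh iterD hK.
Qed.

(* The reflection fixing the odd column v0 would otherwise fix another column *)
(* or a bundle of parallel X-edges in between.                                *)
Let no_return r s t : 0 < r < M.*2 -> iter s.*2 U (p r) <> iter t.*2 U v0.
Proof.
move=> lr E; set l := r./2; set v := p l.
have E1 : iter s.*2 U (iter l sh (iter (odd r) sh v)) = iter t.*2 U v0.
  by rewrite -E /v !pD; congr (iter _ U (p _)); rewrite /l; lia.
have E2 : iter (l + s).*2 U (iter (odd r) sh v) = iter t.*2 U (iter h U v).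
  apply: (iter_inj (shift_inj hc) (n := l)).
  rewrite -!(iterU_shift hc) -/sh shift_h doubleD iterD E1 -!iterD addnC.
  by [].
case: (boolP (odd r)) E2 => [or|er] /= E2.
  have E3 : X (iter (l + s).*2 U (U v)) = iter (t + H).*2 U (U v).
    rewrite -(iterU_X hc) -/(shift U X v) -/sh E2 eh -iterD -iterSr.
    by congr iter; lia.
  have E4 : iter (l + s).*2 U (U v) = iter (t + H).*2 U (X (U v)).
    by rewrite (iterU_X hc) -E3 XK.
  have : iter ((l + s) + (l + s)).*2 U (U v) = iter ((t + H) + (t + H)).*2 U
    (U v).
    rewrite [in LHS]doubleD iterD E4 -iterD addnC iterD (iterU_X hc) E3.
    by rewrite -iterD -doubleD.
  move/even_eq; rewrite !addnn => /mod_halve E5.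
  have := E3; rewrite even_mod E5 -even_mod; exact: neqX.
move: E2; rewrite -iterD => /(iter_eq_order_dvdn Uinj) E2.
have : ~~ odd (order U v) by apply: even_inner; rewrite /l; lia.
move=> ev; have := congr1 odd E2; rewrite !odd_mod ?(negPf ev) //.
by rewrite eh oddD !odd_double /= odd_double.
Qed.

(** Translating an equality back to [v0], with the odd period [h] used to repair parities,
    contradicts [no_return] at offset [j - i] or [i + j]. *)
Let disj i j s t : i < j <= M -> iter s U (p i) <> iter t U (p j).
Proof.
move=> ij; have ji : p j = iter i sh (p (j - i)) by rewrite pD subnKC //; lia.
have lr1 : 0 < j - i < M.*2 by lia.
have lr2 : 0 < i + j < M.*2 by lia.
have even a b : iter a.*2 U (p i) <> iter b.*2 U (p j).
  rewrite ji [p i]/p 2!(iterU_shift hc) => /(iter_inj (shift_inj hc)) /esym.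
  exact: no_return.
case: (boolP (odd s)) => os; case: (boolP (odd t)) => ot.
- rewrite -(odd_double_half s) -(odd_double_half t) os ot !add1n !iterS.
  by move/Uinj; exact: even.
- rewrite -(odd_double_half s) -(odd_double_half t) os (negPf ot) add1n add0n.
  move/(congr1 (iter i sh)).
  rewrite iterSr -!(iterU_shift hc) (shift_U_shift hc) pD -iterD.
  rewrite -[v0 in LHS]hK -iterD.
  have -> : s./2.*2 + i.*2.+1 + h = (s./2 + i + H.+1).*2 by rewrite eh; lia.
  by move/esym; exact: no_return.
- rewrite -(odd_double_half s) -(odd_double_half t) ot (negPf os) add1n add0n.
  move/(congr1 (iter j sh)).
  rewrite [in RHS]iterSr -!(iterU_shift hc) (shift_U_shift hc) pD -iterD.
  rewrite -[v0 in RHS]hK -iterD.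
  have -> : t./2.*2 + j.*2.+1 + h = (t./2 + j + H.+1).*2 by rewrite eh; lia.
  by apply: no_return; lia.
- rewrite -(odd_double_half s) -(odd_double_half t) (negPf os) (negPf ot).
  exact: even.
Qed.

Let inner_eq i s t : 0 < i < M -> iter s U (p i) = iter t U (p i) ->
  s = t %[mod h.*2].
Proof.
move=> li /(iter_eq_order_dvdn Uinj).
suff -> : order U (p i) = h.*2 by [].
apply/eqP; rewrite eqn_dvd (iter_order_dvdn Uinj (U2h _)) /=.
have eo : order U (p i) = (order U (p i))./2.*2.
  by rewrite -[LHS]odd_double_half (negPf (even_inner li)).
rewrite eo -!muln2 dvdn_pmul2r //; apply: (even_period (v := p i)).
by rewrite -eo iter_order.
Qed.

(** One closed strand: both ends of the single deleted edge of column 0 send out a lane, the lanes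
    run in parallel through the inner columns, and they meet again in the single deleted edge of
    column [M]. *)
Let P v := [exists i : 'I_M.+1,
  (i < M) && (v == p i) || (0 < i) && (v == iter H.*2 U (p i))].

Let P_low i : i < M -> P (p i).
Proof.
move=> li; apply/existsP; exists (Ordinal (leqW li)).
by rewrite /= li eqxx.
Qed.

Let P_high i : 0 < i <= M -> P (iter H.*2 U (p i)).
Proof.
case/andP=> i0 li; apply/existsP; exists (Ordinal (li : i < M.+1)).
by rewrite /= i0 eqxx orbT.
Qed.

Let P_cases v : P v ->
  (exists2 i, i < M & v = p i) \/ (exists2 i,
    0 < i <= M & v = iter H.*2 U (p i)).
Proof.
case/existsP=> -[i li] /= /orP [] /andP [ci /eqP ->]; [left | right];
  exists i => //.
by rewrite ci.
Qed.

Let same_column i j s t : i <= M -> j <= M ->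
  iter s U (p i) = iter t U (p j) -> i = j.
Proof.
move=> li lj E; have [lt|lt|//] := ltngtP i j.
  by case: (@disj i j s t); rewrite ?lt.
by case: (@disj j i t s); rewrite ?lt.
Qed.

Let P_disj v : P v -> ~~ P (U v).
Proof.
move=> Pv; apply/negP => PUv.
case: (P_cases Pv) => -[i li ev]; case: (P_cases PUv) => -[j lj].
all: rewrite ev => E.
- have ij := @same_column i j 1 0 (ltnW li) (ltnW lj) E.
  by rewrite ij in E; exact: neqU E.
- have [/andP [j0 jM] iM] := (lj, ltnW li).
  have ij := @same_column i j 1 H.*2 iM jM E.
  rewrite ij in E li; have := @inner_eq j 1 H.*2; rewrite j0 li => /(_ isT E).
  by rewrite !modn_small ?eh; lia.
- have [/andP [i0 iM] jM] := (li, ltnW lj).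
  have ij := @same_column i j H.*2.+1 0 iM jM E.
  rewrite ij in E i0; have := @inner_eq j H.*2.+1 0;
    rewrite i0 lj => /(_ isT E).
  by rewrite !modn_small ?eh; lia.
have [/andP [i0 iM] /andP [j0 jM]] := (li, lj).
have ij := @same_column i j H.*2.+1 H.*2 iM jM E.
by rewrite ij in E; exact: neqU E.
Qed.

Let XU i s : X (iter s.*2.+1 U (p i)) = iter s.*2 U (p i.+1).
Proof. by rewrite iterSr -(iterU_X hc). Qed.

Let XS i s : X (iter s.*2 U (p i.+1)) = iter s.*2.+1 U (p i).
Proof. by rewrite -XU XK. Qed.

Let P_X v : P v || P (U' v) -> P (X v) || P (U' (X v)).
Proof.
have up w q : P q -> w = U q -> P w || P (U' w) by move=> Pq ->;
  rewrite UK Pq orbT.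
have hU i : U (iter H.*2 U (p i)) = iter h U (p i) by rewrite eh.
case/orP=> /P_cases [] [i li] ev.
- case: i li ev => [|i] li ->; last by apply: (up _ (p i)); [apply: P_low;
  lia | exact: (XS i 0)].
  have -> : X (p 0) = iter H.*2 U (p 1) by rewrite -(XU 0 H) -eh hK.
  by rewrite (P_high (i := 1)).
- case: i li ev => // i li ->; rewrite XS -eh; case: i li => [|i] li.
    by rewrite (hK : iter h U (p 0) = p 0) (P_low M_gt0).
  by apply: up; [apply: (P_high (i := i.+1)); lia | rewrite hU].
- have -> : X v = p i.+1 by rewrite -[v]U'K ev.
  have [lt|ge] := ltnP i.+1 M; first by rewrite (P_low lt).
  have -> : i.+1 = M by lia.
  by apply: up; [apply: (P_high (i := M)); lia | rewrite hU hKM].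
have -> : v = iter h U (p i) by rewrite -hU -ev U'K.
have [lt|ge] := ltnP i M; first by rewrite eh XU (P_high (i := i.+1)).
have -> : i = M by lia.
rewrite hKM -(prednK M_gt0) (XS _ 0).
by apply: (up _ (p M.-1)); [apply: P_low; lia |].
Qed.

Let C := connect (opened U U' X P).

Let Csym : connect_sym (opened U U' X P).
Proof. exact: (opened_csym hc). Qed.

(** An inner column is cut into two arcs, ending at [p i] and at [iter H.*2 U (p i)]. The X-edges at
    the starts of these arcs lead to the corresponding two vertices of column [i.+1], so induction
    applies. *)
Let C_column i : 0 < i <= M -> C v0 (p i) /\ C v0 (iter H.*2 U (p i)).
Proof.
have notP0 s : 0 < s < h -> ~~ P (iter s U (p 0)).
  move=> ls; apply/negP => /P_cases [] [j lj E].
    have j0 := @same_column 0 j s 0 (leq0n _) (ltnW lj) E; rewrite -j0 in E.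
    by have := iter_order_dvdn Uinj E; rewrite order_v0 => /dvdn_leq; lia.
  case/andP: lj => j0 lj; have := same_column (leq0n _) lj E; lia.
have notP k s : 0 < k < M -> 0 < s < h.*2 -> s != H.*2 -> ~~ P (iter s U (p k)).
  move=> lk ls ns; have kM : k <= M by lia.
  apply/negP => /P_cases [] [j lj E].
    have kj := @same_column k j s 0 kM (ltnW lj) E.
    rewrite -kj in E; have := @inner_eq k s 0 lk E.
    by rewrite ?modn_small; lia.
  case/andP: lj => j0 lj.
  have kj := same_column kM lj E; rewrite -kj in E.
  by have := inner_eq lk E; rewrite ?modn_small ?eh; lia.
elim: i => // i IH li; have [i0|i0] := posnP i.
  rewrite i0; split.
    apply: (connect_trans (y := U v0)); last first.
      exact: (opened_crossU hc (P_low M_gt0)).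
    have E : v0 = iter h.-1 U (U v0) by rewrite -iterSr prednK ?hK // eh.
    rewrite Csym [Z in connect _ _ Z]E; apply: opened_climb => s ls.
    by rewrite -iterSr; apply: notP0; lia.
  rewrite -(XU 0 H) -eh (hK : iter h U (p 0) = p 0).
  by apply: opened_cross; rewrite (P_low M_gt0).
have lt : i < M by lia.
have [CA CB] := IH (introT andP (conj i0 (ltnW lt))); split.
  apply: (connect_trans CB); apply: (connect_trans (y := U (p i))); last first.
    exact: (opened_crossU hc (P_low lt)).
  rewrite Csym; have -> : iter H.*2 U (p i) = iter H.*2.-1 U (U (p i)).
    by rewrite -iterSr prednK // double_gt0.
  by apply: opened_climb => s ls; rewrite -iterSr; apply: notP; lia.
apply: (connect_trans CA).
apply: (connect_trans (y := iter H.*2.+1 U (p i))); last first.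
  rewrite -XU; apply: (opened_crossU hc); apply: P_high; lia.
rewrite Csym -eh -[Z in connect _ _ Z](U2h (p i)) -addnn iterD.
by apply: opened_climb => s ls; rewrite -iterD; apply: notP; lia.
Qed.

(** Around a column of odd length both sides are the same, so crossing out of column 0 or column [M]
    always leads back in between. *)
Let reach v : exists i n, i <= M /\ v = iter n U (p i).
Proof.
apply: (hc_trans hc (v := v0)
  (S := fun v => exists i n, i <= M /\ v = iter n U (p i))).
- by exists 0, 0.
- by move=> u [i [n [li ->]]]; exists i, n.+1.
move=> u [i [n [li ->]]]; rewrite -(odd_double_half n).
have Xeven k s : k <= M -> exists i n,
  i <= M /\ X (iter s.*2 U (p k)) = iter n U (p i).
  case: k => [|k] lk; last by exists k, s.*2.+1; rewrite XS; split=> //; lia.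
  exists 1, (s.*2 + H.*2); split=> //.
  by rewrite -(hK : iter h U (p 0) = p 0) -iterD eh addnS -doubleD XU.
case: (odd n); last by rewrite add0n; exact: Xeven.
rewrite add1n; have [lt|ge] := ltnP i M; first by exists i.+1, n./2.*2;
  rewrite XU.
have -> : i = M by lia.
rewrite -hKM -iterD (_ : _ + h = (n./2 + H.+1).*2); first exact: Xeven.
by rewrite eh; lia.
Qed.

Let reach_P v : exists n, P (iter n U v).
Proof.
have [i [n [li ->]]] := reach v.
have back : iter (h.*2 * n - n + n) U (p i) = p i.
  rewrite subnK; last by rewrite leq_pmull // eh.
  rewrite mulnC iterM.
  by elim: n => //= n ->; exact: U2h.
have [lt|ge] := ltnP i M.
  by exists (h.*2 * n - n); rewrite -iterD back P_low.
exists (H.*2 + (h.*2 * n - n)); rewrite -iterD -addnA iterD back.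
by apply: P_high; lia.
Qed.

Lemma hamiltonian_of_odd_column_aux :
  exists c, hamiltonian_cycle (honeycomb_adj U U' X) c.
Proof.
apply: (hamiltonian_of_strands hc P_disj P_X); first by apply/card_gt0P;
  exists v0.
have C0 v : C v0 v.
  have [n Pn] := reach_P v; have [q Pq Cq] := opened_reach U' X Pn.
  rewrite /C Csym; apply: connect_trans Cq _; rewrite Csym -/C.
  case: (P_cases Pq) => -[i li ->]; last by have [] := C_column li.
  by case: (posnP i) => [->|i0]; [exact: connect0 | have [|] := @C_column i;
    [lia|]].
by move=> v w; apply: (connect_trans (y := v0)); [rewrite Csym|]; exact: C0.
Qed.

End OddColumn.

Lemma hamiltonian_of_odd_column (T : finType) (U U' X : T -> T) (v : T) :
  honeycomb U U' X -> odd (order U v) ->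
  exists c, hamiltonian_cycle (honeycomb_adj U U' X) c.
Proof.
move=> hc ov.
have ex : exists i, (0 < i) && odd (order U (iter i (shift U X) v)).
  exists #|T|`!; rewrite fact_gt0 iter_card_fact //; exact: (shift_inj hc).
case: (ex_minnP ex) => M /andP [M0 oM] Mmin.
apply: (hamiltonian_of_odd_column_aux hc (v0 := v) (h := order U v)
          (H := (order U v)./2) (M := M)) => //.
  by rewrite -[LHS]odd_double_half ov.
move=> i /andP [i0 iM]; apply/negP => oi.
by have := Mmin i; rewrite i0 oi => /(_ isT); lia.
Qed.

(** * Mirroring and turning a honeycomb *)

Lemma closed_inverse (T : finType) (f g : T -> T) (S : T -> Prop) :
  cancel f g -> cancel g f -> (forall u, S u -> S (f u)) -> forall u, S u ->
    S (g u).
Proof.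
move=> fK gK Sf u Su; have injf := can_inj fK.
have -> : g u = iter #|T|`!.-1 f u.
  by apply: (injf); rewrite gK -iterS prednK ?fact_gt0 // iter_card_fact.
by elim: _.-1 => //= n /Sf.
Qed.

Lemma hamiltonian_cycle_sub (T : finType) (e e' : rel T) (c : seq T) :
  subrel e e' -> hamiltonian_cycle e c -> hamiltonian_cycle e' c.
Proof.
move=> sub [[/andP [cc uc] sc] allc]; do 2?split=> //.
by apply/andP; split=> //; apply: sub_cycle cc.
Qed.

Lemma honeycomb_mirror (T : finType) (U U' X : T -> T) :
  honeycomb U U' X -> honeycomb U' U X.
Proof.
move=> [UK U'K XK comm free trans]; split=> //.
- by move=> v; apply: (can_inj UK); apply: (can_inj UK); rewrite comm !U'K.
- move=> v; have := free v; rewrite /= !inE !negb_or !andbT.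
  by case/and3P=> /and3P[-> -> ->] /andP[-> ->]; rewrite eq_sym => ->.
move=> v S Sv SU' SX; apply: trans (Sv) _ SX.
exact: closed_inverse U'K UK SU'.
Qed.

(* Rotating the frames by a third of a turn on a two-coloured honeycomb: the   *)
(* edges {v, U v} with v white become the new X-edges.                        *)
Section Turn.

Variables (T : finType) (U U' X : T -> T).
Hypothesis hc : honeycomb U U' X.
Variable white : T -> bool.
Hypothesis white_U : forall v, white (U v) = ~~ white v.
Hypothesis white_X : forall v, white (X v) = ~~ white v.

Let white_U' v : white (U' v) = ~~ white v.
Proof. by rewrite -[in RHS](hc_U'K hc v) white_U negbK. Qed.

Let whiteE := (white_U, white_X, white_U').

Definition turnX v := if white v then U v else U' v.
Definition turnU v := if white v then X v else U v.
Definition turnU' v := if white v then U' v else X v.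

Lemma honeycomb_turn : honeycomb turnU turnU' turnX.
Proof.
case: hc => UK U'K XK comm free trans.
have tUK : cancel turnU turnU'.
  by move=> v; rewrite /turnU /turnU'; case wv: (white v);
    rewrite !whiteE wv /= ?XK ?UK.
have tU'K : cancel turnU' turnU.
  by move=> v; rewrite /turnU /turnU'; case wv: (white v);
    rewrite !whiteE wv /= ?XK ?U'K.
split=> //.
- by move=> v; rewrite /turnX; case wv: (white v);
  rewrite !whiteE wv /= ?U'K ?UK.
- move=> v; rewrite /turnX /turnU; case wv: (white v).
    by do 4!rewrite ?(whiteE, wv) /=; rewrite comm.
  do 4!rewrite ?(whiteE, wv) /=.
  by apply: (can_inj UK); rewrite U'K comm U'K.
- move=> v; have := free v; rewrite /turnX /turnU /turnU' /= !inE !negb_or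
  !andbT.
  case: ifP => _ /and3P[/and3P[nX nU nU'] /andP[XU XU'] UU'].
    by rewrite nX nU nU' XU' UU' eq_sym XU.
  by rewrite nX nU nU' (eq_sym (U' v)) UU' (eq_sym (U' v)) XU' eq_sym XU.
move=> v S Sv SU SX; apply: trans (Sv) _ _ => u Su.
  by have := SX _ Su; have := SU _ Su; rewrite /turnX /turnU; case: ifP.
have := closed_inverse tUK tU'K SU Su; have := SU _ Su.
by rewrite /turnU /turnU'; case: ifP.
Qed.

(** The hypotheses amount to [kappa] changing along the turned columns and being constant on the
    turned X-edges. *)
Lemma hamiltonian_of_turned_alternation (kappa : T -> bool) (p : T) :
  (forall v, kappa (X v) = ~~ kappa v) ->
  (forall v, kappa (U v) = white v (+) ~~ kappa v) ->
  exists c, hamiltonian_cycle (honeycomb_adj U U' X) c.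
Proof.
move=> kX kU.
have kU' v : kappa (U' v) = white v (+) kappa v.
  have := kU (U' v); rewrite (hc_U'K hc) white_U' => ->.
  by case: (white v); case: (kappa _).
have [||c hamc] := hamiltonian_of_alternation honeycomb_turn (kappa := kappa)
  _ _ p.
- by move=> v; rewrite /turnU; case: ifP => wv; rewrite ?kX ?kU ?wv.
- move=> v; rewrite /turnX; case: ifP => wv; rewrite ?kU ?kU' ?wv //=.
  by rewrite negbK.
exists c; apply: hamiltonian_cycle_sub hamc => v w.
rewrite /honeycomb_adj /turnU /turnX /turnU'.
by case: ifP => _ /or3P [] ->; rewrite ?orbT.
Qed.

End Turn.

(** * Coordinates on honeycombs with even columns *)

Section Coordinates.

Variables (T : finType) (U U' X : T -> T).
Hypothesis hc : honeycomb U U' X.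
Hypothesis even_columns : forall v, ~~ odd (order U v).
Variables (v0 : T) (h : nat).
Hypothesis order_v0 : order U v0 = h.*2.

Let UK := hc_UK hc.
Let U'K := hc_U'K hc.
Let XK := hc_XK hc.
Let Uinj := U_inj hc.
Local Notation sh := (shift U X).

(* Height j in column i; the X-edges from column i to column i + 1 are those   *)
(* at odd heights of column i.                                                 *)
Definition pos i j := iter j U (iter i sh v0).

Lemma pos_U i j : U (pos i j) = pos i j.+1. Proof. by []. Qed.

Lemma iter_pos n i j : iter n U (pos i j) = pos i (n + j).
Proof. by rewrite /pos iterD. Qed.

Lemma pos_X i j : odd j -> X (pos i j) = pos i.+1 j.-1.
Proof.
move=> oj; rewrite /pos -(odd_double_half j) oj add1n iterSr -(iterU_X hc).
by [].
Qed.

Lemma pos_XS i j : ~~ odd j -> X (pos i.+1 j) = pos i j.+1.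
Proof. by move=> ej; apply: (can_inj XK); rewrite XK pos_X. Qed.

Lemma pos_Xblack i y : X (pos i y.*2.+1) = pos i.+1 y.*2.
Proof. by rewrite (pos_X i (j := y.*2.+1)) //= odd_double. Qed.

Lemma pos_Xwhite i y : X (pos i.+1 y.*2) = pos i y.*2.+1.
Proof. by rewrite -pos_Xblack XK. Qed.

Lemma pos_period i j : pos (i + #|T|`!) j = pos i j.
Proof. by rewrite /pos iterD iter_card_fact //; exact: (shift_inj hc). Qed.

Lemma pos_periodM n i j : pos (i + n * #|T|`!) j = pos i j.
Proof. by elim: n => [|n IH]; rewrite ?addn0 // mulSn addnCA addnC pos_period.
  Qed.

Lemma pos_surj v : exists i j, v = pos i j.
Proof.
apply: (hc_trans hc (v := v0) (S := fun v => exists i j, v = pos i j)).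
- by exists 0, 0.
- by move=> u [i [j ->]]; exists i, j.+1.
move=> u [i [j ->]]; case: (boolP (odd j)) => oj.
  by exists i.+1, j.-1; rewrite pos_X.
exists (i + #|T|`!).-1, j.+1; rewrite -pos_XS //.
by rewrite prednK ?pos_period // addn_gt0 fact_gt0 orbT.
Qed.

Lemma h_gt0 : 0 < h.
Proof. by rewrite -double_gt0 -order_v0 order_gt0. Qed.

Lemma U_period v : iter h.*2 U v = v.
Proof.
have [i [j ->]] := pos_surj v.
rewrite iter_pos addnC -iter_pos; congr iter; rewrite /pos (iterU_shift hc).
by rewrite -order_v0 iter_order.
Qed.

Lemma pos_eq_column i j j' : pos i j = pos i j' -> j = j' %[mod h.*2].
Proof.
have ord : order U (pos i 0) = h.*2.
  apply/eqP; rewrite eqn_dvd (iter_order_dvdn Uinj (U_period _)) /=.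
  set o := order _ _; have eo : o = o./2.*2.
    by rewrite -[LHS]odd_double_half (negPf (even_columns _)).
  rewrite -order_v0 (iter_order_dvdn Uinj) //.
  apply: (iter_inj (shift_inj hc) (n := i)).
  by rewrite eo -(iterU_shift hc) -eo iter_order.
by rewrite /pos => /(iter_eq_order_dvdn Uinj); rewrite -/(pos i 0) ord.
Qed.

(* Otherwise a reflection of the plane would fix a column of odd length. *)
Lemma pos_neq_reflect i i' j j' :
  odd j -> ~~ odd j' -> ~~ odd (i + i') -> pos i j <> pos i' j'.
Proof.
move=> oj ej eii; wlog le : i eii / i' <= i => [W|].
  rewrite -(pos_periodM i'.*2); apply: W.
    by rewrite addnAC oddD oddM odd_double addbF.
  by have := fact_gt0 #|T|; nia.
move=> E; set l := (i - i')./2.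
have ei : i = l + (l + i').
  by rewrite addnA addnn even_halfK ?subnK // oddB // -oddD.
have ej2 : j = j./2.*2.+1 by rewrite -[LHS]odd_double_half oj.
have ej2' : j' = j'./2.*2 by rewrite -[LHS]odd_double_half (negPf ej).
have := congr1 (iter l sh) E; rewrite /pos ej2 ej2' ei.
rewrite iterSr -!(iterU_shift hc) iterD (shift_U_shift hc) -!iterD.
move/(iter_eq_order_dvdn Uinj)/(congr1 odd).
rewrite !odd_mod ?(negPf (even_columns _)) //.
by rewrite addnS -doubleD /= !odd_double.
Qed.

Lemma pos_descend (A : Type) (Q : nat -> nat -> A) :
  (forall i j i' j', pos i j = pos i' j' -> Q i j = Q i' j') ->
  exists f : T -> A, forall i j, f (pos i j) = Q i j.
Proof.
move=> QE; have /fin_all_exists [dec decE] v : exists ij, v = pos ij.1 ij.2.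
  by have [i [j ->]] := pos_surj v; exists (i, j).
by exists (fun v => Q (dec v).1 (dec v).2) => i j; apply: QE; rewrite -decE.
Qed.

Variables (m c : nat).
Hypothesis m_gt0 : 0 < m.
Hypothesis m_c : iter m sh v0 = iter c.*2 U v0.
Hypothesis m_min : forall i t, 0 < i -> iter i sh v0 = iter t.*2 U v0 -> m <= i.

Lemma pos_addm i j : pos (i + m) j = pos i (j + c.*2).
Proof. by rewrite /pos iterD m_c -(iterU_shift hc) iterD. Qed.

Lemma pos_addmM i j n : pos (i + n * m) j = pos i (j + (n * c).*2).
Proof.
elim: n j => [|n IH] j; first by rewrite !addn0.
by rewrite mulSn addnCA addnC pos_addm IH mulSn doubleD addnA.
Qed.

Lemma pos_addh i j : pos i (j + h.*2) = pos i j.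
Proof. by rewrite addnC -iter_pos U_period. Qed.

Lemma pos_addhM i j n : pos i (j + n * h.*2) = pos i j.
Proof. by elim: n => [|n IH]; rewrite ?addn0 // mulSn addnCA addnC pos_addh.
  Qed.

(** Reducing the column difference modulo [m] would otherwise leave a return to the column of [v0]
    shorter than the minimal one. *)
Lemma pos_eq_mod i i' j j' : odd j = odd j' -> pos i j = pos i' j' ->
  i = i' %[mod m].
Proof.
wlog le : i i' j j' / i' <= i => [W o E|].
  case/orP: (leq_total i' i) => le; first exact: W le o E.
  by symmetry; exact: W le (esym o) (esym E).
move=> o E; have [r ri] : exists r, i = i' + r by exists (i - i');
  rewrite subnKC.
have {E} [s [t E]] : exists s t, iter s.*2 U (iter r sh v0) = iter t.*2 U v0.
  exists j./2, j'./2; apply: (iter_inj (shift_inj hc) (n := i')).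
  rewrite -!(iterU_shift hc) -iterD -ri.
  have ej := esym (odd_double_half j); have ej' := esym (odd_double_half j').
  move: E; rewrite /pos {1}ej {1}ej' -o.
  by case: (odd j); rewrite ?add1n ?add0n ?iterS // => /Uinj.
have {}E : iter r sh v0 = iter (t + (h * s - s)).*2 U v0.
  rewrite doubleD addnC iterD -E -iterD -doubleD subnK ?leq_pmull ?h_gt0 //.
  rewrite mulnC doubleMr iterM.
  by elim: s {E} => //= s <-; rewrite U_period.
move: (t + _) E => {}t E; rewrite ri -modnDmr.
suff -> : r %% m = 0 by rewrite addn0.
case: (posnP (r %% m)) => // r0.
have := ltn_pmod r m_gt0; rewrite ltnNge => /negP[].
have E2 : pos 0 t.*2 = pos (r %% m) (r %/ m * c).*2.
  have := pos_addmM (r %% m) 0 (r %/ m); rewrite addnC -divn_eq add0n => <-.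
  by rewrite /pos /= E.
move: (r %/ m * c) E2 => n /(congr1 (iter (h * n - n).*2 U)).
rewrite !iter_pos -!doubleD subnK ?leq_pmull ?h_gt0 // (mulnC h) doubleMr.
by rewrite (pos_addhM _ 0 n) => /esym; exact: m_min.
Qed.

(** [i + j] is the height when X-edges are drawn horizontally. Its parity descends: the column index
    is determined modulo the even [m], and by [pos_neq_reflect] a change of parity in [j] is
    accompanied by one in [i]. *)
Lemma hamiltonian_of_even_width :
  ~~ odd m -> exists c, hamiltonian_cycle (honeycomb_adj U U' X) c.
Proof.
move=> em; have [|kappa kE] := @pos_descend _ (fun i j => odd (i + j)).
  move=> i j i' j' E; rewrite !oddD; have [o|o] := eqVneq (odd j) (odd j').
    have /(congr1 odd) := pos_eq_mod o E.
    by rewrite !odd_mod ?(negPf em) // o => ->.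
  have : odd (i + i').
    apply: contraT => eii; case: (boolP (odd j)) o => oj;
      case: (boolP (odd j')) => oj' // _.
      by case: (pos_neq_reflect oj oj' eii E).
    by rewrite addnC in eii; case: (pos_neq_reflect oj' oj eii (esym E)).
  by rewrite oddD; case: (odd i) (odd i') (odd j) (odd j') o => [] [] [] [].
apply: (hamiltonian_of_alternation hc (kappa := kappa) _ _ v0) => v;
  have [i [j ->]] := pos_surj v.
  by rewrite pos_U !kE addnS.
case: (boolP (odd j)) => oj.
  by rewrite pos_X // !kE addSnnS prednK //; case: j oj.
rewrite -(pos_period i j); set i' := i + _.
have -> : i' = i'.-1.+1 by rewrite prednK // addn_gt0 fact_gt0 orbT.
by rewrite pos_XS // !kE addSnnS.
Qed.

Section OddWidth.

Hypothesis odd_m : odd m.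

(** Going once around changes the parity of the column index but not of the height, so for odd [m]
    the reflections left open by [pos_neq_reflect] are excluded too: the surface is a torus,
    two-coloured by the parity of [j]. *)
Lemma pos_color i i' j j' : pos i j = pos i' j' -> odd j = odd j'.
Proof.
move=> E; apply/eqP; apply: contraT => o.
have E2 : pos i (c.*2 + j) = pos (i' + m) j'.
  by rewrite -iter_pos E iter_pos pos_addm addnC.
have [eii|oii] := boolP (odd (i + i')); last first.
  case: (boolP (odd j)) o => oj; case: (boolP (odd j')) => oj' // _.
    by case: (pos_neq_reflect oj oj' oii E).
  by rewrite addnC in oii; case: (pos_neq_reflect oj' oj oii (esym E)).
have eim : ~~ odd (i + (i' + m)) by rewrite addnA oddD eii odd_m.
case: (boolP (odd j)) o => oj; case: (boolP (odd j')) => oj' // _.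
  by case: (pos_neq_reflect _ oj' eim E2); rewrite oddD odd_double.
rewrite addnC in eim.
by case: (pos_neq_reflect oj' _ eim (esym E2)); rewrite oddD odd_double.
Qed.

(** A function of the coordinates need only respect the two generating periods of the torus. *)
Lemma pos_descend_periodic (A : Type) (Q : nat -> nat -> A) :
  (forall i j, Q i (j + h.*2) = Q i j) ->
  (forall i j, Q (i + m) j = Q i (j + c.*2)) ->
  exists f : T -> A, forall i j, f (pos i j) = Q i j.
Proof.
move=> Qh Qm.
have QhM n i j : Q i (j + n * h.*2) = Q i j.
  by elim: n => [|n IH]; rewrite ?addn0 // mulSn addnCA addnC Qh.
have Qmod i j j' : j = j' %[mod h.*2] -> Q i j = Q i j'.
  move=> E; rewrite (divn_eq j h.*2) (divn_eq j' h.*2) E.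
  by rewrite ![_ * _ + _]addnC !QhM.
have QmM n i j : Q (i + n * m) j = Q i (j + (n * c).*2).
  elim: n j => [|n IH] j; first by rewrite !addn0.
  by rewrite mulSn addnCA addnC Qm IH mulSn doubleD addnA.
apply: pos_descend => i j i' j'.
wlog le : i i' j j' / i' <= i => [W E|E].
  by case/orP: (leq_total i' i) => le; [|symmetry]; apply: W le _; rewrite E.
have eim := pos_eq_mod (pos_color E) E.
have [n ei] : exists n, i = i' + n * m.
  have /eqP := eim; rewrite eqn_mod_dvd // => /dvdnP [n en].
  by exists n; rewrite -en subnKC.
move: E; rewrite ei pos_addmM QmM => /pos_eq_column; exact: Qmod.
Qed.

(** The two periods change [i + j./2] by [h] and [m - c], and [uphalf j] by [h] and [-c]. With [h]
    even and [m] odd, the parity of [c] decides which of them is well defined modulo 2 and serves as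
    [kappa] in one of the two other edge directions. *)
Lemma hamiltonian_of_even_height :
  ~~ odd h -> exists c, hamiltonian_cycle (honeycomb_adj U U' X) c.
Proof.
move=> eh.
have [||white wE] := @pos_descend_periodic _ (fun _ j => ~~ odd j).
- by move=> _ j; rewrite oddD odd_double addbF.
- by move=> _ j; rewrite oddD odd_double addbF.
have white_U v : white (U v) = ~~ white v.
  by have [i [j ->]] := pos_surj v; rewrite pos_U !wE.
have Xwhite v : white v -> ~~ white (X v) /\ exists i y, v = pos i.+1 y.*2.
  have [i [j ->]] := pos_surj v; rewrite wE => oj.
  rewrite -(pos_period i j); set i' := i + _.
  have -> : i' = i'.-1.+1 by rewrite prednK // addn_gt0 fact_gt0 orbT.
  rewrite pos_XS // wE /= negbK; split=> //; exists i'.-1, j./2.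
  by rewrite even_halfK.
have Xblack v : ~~ white v -> white (X v) /\ exists i y, v = pos i y.*2.+1.
  have [i [j ->]] := pos_surj v; rewrite wE negbK => oj.
  rewrite pos_X // wE; split; first by case: j oj.
  by exists i, j./2; rewrite -{1}(odd_double_half j) oj.
have white_X v : white (X v) = ~~ white v.
  by case: (boolP (white v)) => [/Xwhite [/negPf] | /Xblack []].
have half_b y : y.*2.+1./2 = y by exact: uphalf_double.
have uphalf_b y : uphalf y.*2.+1 = y.+1 by rewrite uphalfE /= doubleK.
have half_h j : (j + h.*2)./2 = j./2 + h by rewrite halfD odd_double andbF
  add0n doubleK.
have half_c j : (j + c.*2)./2 = j./2 + c by rewrite halfD odd_double andbF
  add0n doubleK.
case: (boolP (odd c)) => oc.
  have [||kappa kE] := @pos_descend_periodic _ (fun i j => odd (i + j./2)).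
  - by move=> i j; rewrite half_h addnA [in LHS]oddD (negPf eh) addbF.
  - by move=> i j; rewrite half_c addnAC addnA !oddD odd_m oc.
  apply: (hamiltonian_of_turned_alternation hc white_U white_X (kappa :=
    kappa) v0).
    move=> v; case: (boolP (white v)) => [/Xwhite|/Xblack] [_ [i [y ->]]].
      by rewrite pos_Xwhite !kE half_b doubleK addSn /= negbK.
    by rewrite pos_Xblack !kE half_b doubleK addSn.
  move=> v; have [i [j ->]] := pos_surj v.
  rewrite pos_U !kE wE /= uphalf_half !oddD.
  by case: (odd j); case: (odd i); case: (odd j./2).
have [||kappa kE] := @pos_descend_periodic _ (fun _ j => odd (uphalf j)).
- move=> _ j; have -> : uphalf (j + h.*2) = uphalf j + h by lia.
  by rewrite oddD (negPf eh) addbF.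
- move=> _ j; have -> : uphalf (j + c.*2) = uphalf j + c by lia.
  by rewrite oddD (negPf oc) addbF.
have [|||c0 hamc] := @hamiltonian_of_turned_alternation _ _ _ _
  (honeycomb_mirror hc) white _ white_X kappa v0.
- by move=> v; rewrite -[in RHS](U'K v) white_U negbK.
- move=> v; case: (boolP (white v)) => [/Xwhite|/Xblack] [_ [i [y ->]]].
    by rewrite pos_Xwhite !kE uphalf_b uphalf_double.
  by rewrite pos_Xblack !kE uphalf_b uphalf_double /= negbK.
- move=> v; rewrite -{2 3}(U'K v); have [i [j ->]] := pos_surj (U' v).
  rewrite pos_U !kE wE /= uphalf_half oddD.
  by case: (odd j); case: (odd j./2).
exists c0; apply: hamiltonian_cycle_sub hamc => v w.
by rewrite /honeycomb_adj => /or3P [] ->; rewrite ?orbT.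
Qed.

(** The only column passes through every vertex, so nothing is deleted. *)
Lemma hamiltonian_of_width_one :
  m = 1 -> exists c, hamiltonian_cycle (honeycomb_adj U U' X) c.
Proof.
move=> m1; apply: (hamiltonian_of_strands hc (P := pred0)) => //.
  by apply/card_gt0P; exists v0.
have C0 v : connect (opened U U' X pred0) v0 v.
  have [i [j ->]] := pos_surj v.
  rewrite -[i]add0n -[i in _ + i]muln1 -[X in _ * X]m1 pos_addmM.
  by apply: opened_climb.
move=> v w; apply: connect_trans (C0 w).
by rewrite (opened_csym hc).
Qed.

End OddWidth.

End Coordinates.

Arguments pos : simpl never.

Lemma modn_window_inj d x y :
  0 < x <= d -> 0 < y <= d -> x = y %[mod d] -> x = y.
Proof.
wlog le : x y / x <= y => [W wx wy E|].
  by case/orP: (leq_total x y) => le; [|symmetry]; apply: W.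
move=> wx wy /eqP; rewrite eq_sym eqn_mod_dvd // /dvdn modn_small;
  first by move/eqP; lia.
lia.
Qed.

(** * Tori with an odd number of odd columns *)

(* l j, a j and r j stand for the pieces of columns 0, 1 and 2 that are met by *)
(* strand j on its left side, in the middle and on its right side; w and s are *)
(* the shifts caused by the other columns and by closing up the torus.         *)
Section StripGluing.

Variables (A : Type) (R : A -> A -> Prop).
Hypotheses (R_refl : forall x, R x x) (R_sym : forall x y, R x y -> R y x).
Hypothesis R_trans : forall y x z, R x y -> R y z -> R x z.

(** By Bezout, a multiple of [q] equals the gcd up to multiples of the period [h]. *)
Lemma periodic_shift (f : nat -> A) q h :
  (forall y, R (f y) (f (y + q))) -> (forall y, f (y + h) = f y) ->
  forall y, R (f y) (f (y + gcdn q h)).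
Proof.
move=> fq fh y; case: (posnP q) => [->|q0]; first by rewrite gcd0n fh.
case: (egcdnP h q0) => km kn E _.
have fhM n x : f (x + n * h) = f x.
  by elim: n => [|n IH]; rewrite ?addn0 // mulSn addnCA addnC fh.
rewrite -(fhM kn (y + _)) -addnA (addnC (gcdn _ _)) -E.
elim: km {E} => [|n IH]; first by rewrite addn0.
by apply: R_trans IH _; rewrite mulSnr addnA; exact: fq.
Qed.

Variables (k w s : nat) (l a r : nat -> A).
Hypotheses (l_per : forall j, l (j + k) = l j) (a_per : forall j,
  a (j + k) = a j)
  (r_per : forall j, r (j + k) = r j).
Hypothesis odd_k : odd k.
(** This is [s - w - 1] modulo [k], written without subtraction. With all strands straight, [l j]
    would be glued to [l (j + rho)], leaving [d] cycles. *)
Let rho := k.-1 * w + s + k.-1.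
Let d := gcdn rho k.
(* The rerouted strands, (d - 1)/2 of them and no two adjacent. *)
Definition bent j := odd (j %% k) && (j %% k < d).

Hypothesis straight_glue : forall j, ~~ bent j -> ~~ bent j.+1 ->
  R (l j.+1) (a j) /\ R (a j.+1) (r j.+1).
Hypothesis bent_glue : forall j, bent j.+1 ->
  [/\ R (a j) (a j.+1), R (a j.+1) (a j.+2), R (l j.+1) (l j.+2)
    & R (r j.+1) (r j.+2)].
Hypothesis wrap_glue : forall j, R (r (j + w)) (l (j + s)).

Let k_gt0 : 0 < k. Proof. by case: k odd_k. Qed.
Let d_k : d %| k. Proof. exact: dvdn_gcdr. Qed.
Let d_rho : d %| rho. Proof. exact: dvdn_gcdl. Qed.
Let odd_d : odd d. Proof. exact: dvdn_odd d_k odd_k. Qed.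
Let d_gt0 : 0 < d. Proof. by case: d odd_d. Qed.
Let d_le_k : d <= k. Proof. exact: dvdn_leq. Qed.

Let perM (f : nat -> A) : (forall j, f (j + k) = f j) ->
  forall n j, f (j + n * k) = f j.
Proof. by move=> fk n j; elim: n => [|n IH];
  rewrite ?addn0 // mulSn addnCA addnC fk. Qed.

Let per_mod (f : nat -> A) : (forall j, f (j + k) = f j) ->
  forall i j, i = j %[mod k] -> f i = f j.
Proof.
move=> fk i j E; rewrite (divn_eq i k) (divn_eq j k) E.
by rewrite ![_ * k + _]addnC !perM.
Qed.

Let wrap j : R (r j) (l (j + rho.+1)).
Proof.
have := wrap_glue (j + k.-1 * w); rewrite -addnA.
have -> : k.-1 * w + w = w * k by rewrite mulnC -mulnSr prednK.
rewrite perM // -addnA -(l_per (j + _)).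
by congr (R _ (l _)); rewrite /rho; lia.
Qed.

Let modS j : j.+1 %% k = if (j %% k).+1 == k then 0 else (j %% k).+1.
Proof.
have lt := ltn_pmod j k_gt0.
rewrite -addn1 -modnDml addn1; case: eqP => [->|ne]; first by rewrite modnn.
by rewrite modn_small // ltn_neqAle lt andbT; apply/eqP.
Qed.

Lemma bent_isolated j : bent j -> ~~ bent j.+1.
Proof.
rewrite /bent modS; case: eqP => //= _ /andP [-> _] //.
Qed.

Let bent0 j : j %% k = 0 -> ~~ bent j.
Proof. by rewrite /bent => ->. Qed.

Let bent_last j : (j %% k).+1 = k -> ~~ bent j.
Proof. by rewrite /bent => E; have := odd_k; rewrite -{1}E /= => /negPf ->. Qed.

Let generic j : d < k -> ~~ (0 < j.+2 %% k <= d) -> R (l j.+2) (l (j.+2 + rho)).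
Proof.
move=> dk out.
have nb : [&& ~~ bent j, ~~ bent j.+1 & ~~ bent j.+2].
  have := modS j; have := modS j.+1; move: odd_d odd_k out; rewrite /bent.
  have := ltn_pmod j k_gt0; move: (j %% k) (j.+1 %% k) (j.+2 %% k) => x y z.
  by do 2!case: eqP; lia.
have /and3P [nb0 nb1 nb2] := nb.
have [L _] := straight_glue nb1 nb2; have [_ B] := straight_glue nb0 nb1.
by apply: R_trans L (R_trans B _); rewrite addSnnS; exact: wrap.
Qed.

(** Outside the window [1, ..., d] straight strands give the shift directly. The window holds one
    representative of each class modulo [d], so the [rho]-orbit of a [j] inside it stays outside
    until it returns to [j]; the rest of the orbit supplies the missing relation backwards. *)
Let l_rho j : R (l j) (l (j + rho)).
Proof.
have [dk|kd] := ltnP d k; last first.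
  have /dvdnP [n ->] : k %| rho.
    by rewrite -(_ : d = k) //; apply/eqP; rewrite eqn_leq d_le_k kd.
  by rewrite perM.
have gen i : ~~ (0 < i %% k <= d) -> R (l i) (l (i + rho)).
  move=> out; have [n en] : exists n, i + 2 * k = n.+2.
    by exists (i + 2 * k - 2); have := k_gt0; lia.
  rewrite -(perM l_per 2 (i + rho)) -(perM l_per 2 i).
  rewrite -addnA (addnC rho) addnA en; apply: generic => //.
  by rewrite -en addnC modnMDl.
have [win|] := boolP (0 < j %% k <= d); last exact: gen.
have exs : exists n, (0 < n) && ((j + n * rho) %% k == j %% k).
  by exists k; rewrite k_gt0 mulnC addnC modnMDl eqxx.
case: (ex_minnP exs) => n /andP [n0 /eqP nE] nmin.
rewrite -(per_mod l_per nE); apply: R_sym.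
suff H i : i < n -> R (l (j + rho)) (l (j + i.+1 * rho)).
  by have := H n.-1; rewrite prednK // leqnn; apply.
elim: i => [|i IH] li; first by rewrite mul1n.
apply: R_trans (IH (ltnW li)) _.
have -> : j + i.+2 * rho = j + i.+1 * rho + rho by rewrite -addnA -mulSnr.
apply: gen; apply/negP => win2.
have Ed : (j + i.+1 * rho) %% k = j %% k %[mod d].
  rewrite !modn_dvdm // -modnDmr; have /dvdnP [x ->] := d_rho.
  by rewrite mulnA modnMl addn0.
have E := modn_window_inj win2 win Ed.
by have := nmin i.+1; rewrite E eqxx => /(_ isT); rewrite leqNgt li.
Qed.

Let l_d j : R (l j) (l (j + d)).
Proof. exact: periodic_shift. Qed.

(** A bent strand [i] joins [l i] to [l i.+1] on its left, and [l i.+1] to [l i.+2] through its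
    right side and the wrap. Each bent strand thus merges three consecutive classes, and those at
    odd [i < d] link all [d]. *)
Let l_next j : R (l j) (l j.+1).
Proof.
have dM n i : R (l i) (l (i + n * d)).
  elim: n => [|n IH]; first by rewrite addn0.
  by apply: R_trans IH _; rewrite mulSnr addnA.
have mod_d i i' : i = i' %[mod d] -> R (l i) (l i').
  move=> E; rewrite (divn_eq i d) (divn_eq i' d) E ![_ * d + _]addnC.
  exact: R_trans (R_sym (dM _ _)) (dM _ _).
have in_d i : 0 < i < d -> R (l i) (l i.+1).
  case: i => // i li; have lk : i.+1 < k by lia.
  have [oi|ei] := boolP (odd i.+1).
    have bi : bent i.+1 by rewrite /bent modn_small // oi; case/andP: li.
    by have [] := bent_glue bi.
  case: i ei li lk => // i ei li lk.
  have bi : bent i.+1.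
    by rewrite /bent modn_small ?(ltnW lk) //; move: ei li => /=;
      rewrite negbK; lia.
  have [_ _ _ rr] := bent_glue bi.
  have E n : R (l n) (l (n + rho)) by exact: l_rho.
  apply: R_trans (E _) _; apply: R_trans (R_sym (E _)).
  rewrite (addSnnS i.+1) (addSnnS i.+2).
  exact: R_trans (R_sym (wrap _)) (R_trans rr (wrap _)).
have [E|ne] := eqVneq (j %% d) 0.
  have [d1|d1] := eqVneq d 1; first by apply: mod_d; rewrite d1 !modn1.
  have : R (l d) (l 1).
    apply: R_sym; suff H i : i < d -> R (l 1) (l i.+1).
      by have := H d.-1; rewrite prednK // leqnn; apply.
    by elim: i => // i IH li; apply: R_trans (IH (ltnW li)) (in_d _ _).
  move=> H; apply: R_trans (mod_d j d _) _; first by rewrite E modnn.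
  by apply: R_trans H (mod_d 1 j.+1 _); rewrite -[j.+1]addn1 -[RHS]modnDml E.
apply: R_trans (mod_d j (j %% d) _) _; first by rewrite modn_mod.
apply: R_trans (in_d _ _) (mod_d _ _ _); first by rewrite lt0n ne ltn_pmod.
by rewrite -addn1 modnDml addn1.
Qed.

Lemma strips_connected :
  [/\ forall i j, R (l i) (l j), forall i j, R (r i) (l j)
    & forall i j, R (a i) (l j)].
Proof.
have ll i j : R (l i) (l j).
  have H n : R (l 0) (l n) by elim: n => // n IH; apply: R_trans IH (l_next n).
  exact: R_trans (R_sym (H i)) (H j).
have rl i j : R (r i) (l j) by apply: R_trans (wrap i) (ll _ _).
(* Middle pieces, by induction on the residue: if strand [i] or its predecessor is bent, [a i] is
   joined to the piece before it, otherwise to [r i]. Residue 0 has no bent strand next to it. *)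
split=> // i j; rewrite -(a_per i).
have [n] : exists n, n = i %% k by exists (i %% k).
elim: n i => [|n IH] i E.
  have -> : i + k = (i + k).-1.+1 by rewrite prednK // addn_gt0 k_gt0 orbT.
  have Ei : (i + k).-1.+1 %% k = 0.
    by rewrite prednK ?modnDr // addn_gt0 k_gt0 orbT.
  have b0 : ~~ bent (i + k).-1.+1 by apply: bent0.
  have b1 : ~~ bent (i + k).-1.
    by apply: bent_last; move: Ei; rewrite modS; case: eqP.
  have [_ ar] := straight_glue b1 b0; exact: R_trans ar (rl _ _).
have ei : i + k = (i + k).-1.+1 by rewrite prednK // addn_gt0 k_gt0 orbT.
set i' := (i + k).-1 in ei *.
have Ei : i'.+1 %% k = n.+1 by rewrite -ei modnDr -E.
have En : n = i' %% k.
  by move: Ei; rewrite modS; case: eqP => // _ [].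
rewrite ei; have IHi := IH _ En; rewrite a_per in IHi.
have [b1|b1] := boolP (bent i'.+1).
  by have [aa _ _ _] := bent_glue b1; exact: R_trans (R_sym aa) IHi.
have [b0|b0] := boolP (bent i').
  case: (posnP i') => [i0|i0]; first by move: b0; rewrite i0 /bent mod0n.
  rewrite -(prednK i0) in b0 IHi *.
  by have [_ aa _ _] := bent_glue b0; exact: R_trans (R_sym aa) IHi.
by have [_ ar] := straight_glue b0 b1; exact: R_trans ar (rl _ _).
Qed.

End StripGluing.

Lemma connect_chain (T : finType) (r : rel T) (x y z : T) :
  connect r x y -> connect r y z -> connect r x z.
Proof. exact: connect_trans. Qed.

(** * Strands on the odd torus *)

Section OddTorus.

Variables (T : finType) (U U' X : T -> T).
Hypothesis hc : honeycomb U U' X.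
Hypothesis even_columns : forall v, ~~ odd (order U v).
Variables (v0 : T) (h w q : nat).
Let m := w.+3.
Let c := q.+1.
Hypothesis order_v0 : order U v0 = h.*2.
Hypothesis m_c : iter m (shift U X) v0 = iter c.*2 U v0.
Hypothesis m_min : forall i t, 0 < i ->
  iter i (shift U X) v0 = iter t.*2 U v0 -> m <= i.
Hypothesis odd_m : odd m.
Hypothesis odd_h : odd h.
Hypothesis q_gt0 : 0 < q.

Let UK := hc_UK hc.
Let U'K := hc_U'K hc.
Let XK := hc_XK hc.
Local Notation pos := (pos U X v0).

Let m_gt0 : 0 < m. Proof. by []. Qed.

Let h_gt0 : 0 < h. Proof. by case: h odd_h. Qed.

Let descend := pos_descend_periodic hc even_columns order_v0 m_gt0 m_c m_min
  odd_m.

Let surj v : exists i j, i < m /\ v = pos i j.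
Proof.
have [i [j ->]] := pos_surj hc v0 v.
exists (i %% m), (j + (i %/ m * c).*2); split; first exact: ltn_pmod.
by rewrite -(pos_addmM hc m_c) addnC -divn_eq.
Qed.

Let surjS v : exists i j, v = pos i.+1 j.+1.
Proof.
have [i [j [_ ->]]] := surj v; exists (i + #|T|`!).-1, (j + h.*2).-1.
rewrite !prednK ?addn_gt0 ?fact_gt0 ?double_gt0 ?h_gt0 ?orbT //.
by rewrite (pos_addh hc order_v0) (pos_period hc).
Qed.

Let posh i y n : pos i (y + n * h).*2 = pos i y.*2.
Proof. by rewrite doubleD doubleMr (pos_addhM hc order_v0). Qed.

Let posm i j : pos (i + m) j = pos i (j + c.*2).
Proof. exact: (pos_addm hc). Qed.

(* When the alternating curve itself passes through every vertex it can be    *)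
(* used in place of its complement.                                           *)
Let hamiltonian_of_coprime :
  coprime q h -> exists c, hamiltonian_cycle (honeycomb_adj U U' X) c.
Proof.
move=> cop.
(* Every second column edge is deleted, with the opposite choice in column 2, and all X-edges stay.
   What remains goes up one edge in each column but down in column 2, and comes around shifted by
   [c - 1 = q] double steps; coprimality makes it one cycle. *)
have [||P PE] := @descend _ (fun i j => odd j (+) (i %% m == 2)).
- by move=> i j; rewrite oddD odd_double addbF.
- by move=> i j; rewrite oddD odd_double addbF modnDr.
have PU v : P (U v) = ~~ P v.
  by have [i [j [_ ->]]] := surj v; rewrite pos_U !PE /= addNb.
have all_ends v : P v || P (U' v) by rewrite -{1}(U'K v) PU orbC orbN.
apply: (hamiltonian_of_strands hc (P := P)).
- by move=> v Pv; rewrite PU Pv.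
- by [].
- by apply/card_gt0P; exists v0.
set R := connect _.
have Rsym : connect_sym (opened U U' X P) by exact: (opened_csym hc).
have RS x y : R x y -> R y x by rewrite /R Rsym.
have cross v : R v (X v) by apply: opened_cross.
have up v : ~~ P v -> R v (U v) by exact: opened_up.
have same i y : i < m -> i != 2 -> R (pos i y.*2) (pos i.+1 y.*2).
  move=> li i2; apply: connect_chain (up _ _) _.
    by rewrite PE odd_double modn_small // (negPf i2).
  by rewrite pos_U -(pos_Xblack hc); exact: cross.
have next y : R (pos 2 y.+1.*2) (pos 3 y.*2).
  apply: (connect_chain (y := pos 2 y.*2.+1)).
    apply: RS; apply: up.
    by rewrite PE /= odd_double modn_small.
  by rewrite -(pos_Xblack hc); exact: cross.
have lastc y : R (pos 3 y.*2) (pos m y.*2).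
  suff H n : n <= w -> R (pos 3 y.*2) (pos n.+3 y.*2) by exact: H.
  elim: n => [|n IH] ln; first exact: connect0.
  by apply: connect_chain (IH (ltnW ln)) (same n.+3 y _ _).
have R01 y : R (pos 0 y.*2) (pos 1 y.*2) by exact: same.
have R12 y : R (pos 1 y.*2) (pos 2 y.*2) by exact: same.
have stepq y : R (pos 0 y.+1.*2) (pos 0 (y.+1 + q).*2).
  apply: connect_chain (connect_chain (R01 y.+1) (R12 y.+1)) _.
  apply: connect_chain (connect_chain (next y) (lastc y)) _.
  by rewrite -[m]add0n posm -doubleD /c addnS addSn.
have step0 y : R (pos 0 y.*2) (pos 0 y.+1.*2).
  have := @periodic_shift _ R (@connect0 _ _) (fun y x z =>
    @connect_chain _ _ x y z)
            (fun y => pos 0 y.*2) q h _ _ y.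
  rewrite (eqP cop) addn1; apply.
    move=> z; rewrite -(posh 0 z 1) -(posh 0 (z + q) 1) mul1n addnAC.
    by rewrite -(prednK h_gt0) addnS; exact: stepq.
  by move=> z; rewrite -(posh 0 z 1) mul1n.
have row0 y : R (pos 0 0) (pos 0 y.*2).
  by elim: y => [|y IH]; [exact: connect0 | exact: connect_chain IH (step0 y)].
have row i y : i < m -> R (pos 0 0) (pos i y.*2).
  elim: i y => [|i IH] y li; first exact: row0.
  have [i2|i2] := eqVneq i 2; last first.
    by apply: connect_chain (IH y (ltnW li)) (same _ _ _ _) => //; lia.
  by rewrite i2 in IH li *; apply: connect_chain (IH y.+1 (ltnW li)) (next y).
have all0 v : R (pos 0 0) v.
  have [i [j [li ->]]] := surj v; case: (boolP (odd j)) => oj; last first.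
    by rewrite -(even_halfK oj); exact: row.
  rewrite -(odd_double_half j) oj; set y := j./2.
  have [i2|i2] := eqVneq i 2.
    rewrite i2; apply: connect_chain (row 2 y.+1 _) _ => //.
    apply: RS; apply: up.
    by rewrite PE /= odd_double modn_small.
  apply: connect_chain (row i y li) _; apply: up.
  by rewrite PE odd_double modn_small // (negPf i2).
by move=> x y; apply: connect_chain (RS _ _ (all0 x)) (all0 y).
Qed.

Section Spaced.

Variables (g k s : nat).
Hypotheses (g_gt1 : 1 < g) (h_kg : h = k * g) (q_sg : q = s * g).

Let odd_k : odd k.
Proof. by move: odd_h; rewrite h_kg oddM => /andP []. Qed.

Let g_gt0 : 0 < g. Proof. exact: ltnW. Qed.

(** Strands are indexed by the multiples of [g] modulo [h]; [B] marks the bent ones and [N] the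
    straight ones. *)
Let G y := g %| y.
Let B y := G y && bent k w s (y %/ g).
Let N y := G y && ~~ B y.

Let G_h y : G (y + h) = G y.
Proof. by rewrite /G h_kg dvdn_addl // dvdn_mull. Qed.

Let bent_k j : bent k w s (j + k) = bent k w s j.
Proof. by rewrite /bent modnDr. Qed.

Let B_h y : B (y + h) = B y.
Proof. by rewrite /B G_h h_kg divnDMl // bent_k. Qed.

Let N_h y : N (y + h) = N y.
Proof. by rewrite /N G_h B_h. Qed.

Let NB y : N y || B y = G y.
Proof. by rewrite /N /B; case: (G y); case: bent. Qed.

Let notG y y' : G y -> y < y' < y + g -> G y' = false.
Proof.
move=> Gy /andP [l1 l2]; apply: negbTE; have -> : y' = y + (y' - y) by lia.
by rewrite /G dvdn_addr // gtnNdvd //; lia.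
Qed.

Let G_B y : G y = false -> B y = false. Proof. by rewrite /B => ->. Qed.
Let G_N y : G y = false -> N y = false. Proof. by rewrite /N => ->. Qed.

(* With w(i,y) = pos i y.*2 and k(i,y) = pos i y.*2.+1, the lower ends of the   *)
(* deleted edges on the strand with index y are w(0,y+1), w(1,y+1), k(2,y) when *)
(* it is straight and k(0,y), w(1,y), w(2,y) when it is bent, followed in both  *)
(* cases by w(i,y) for i > 2.                                                   *)
Let low r j := let y := j./2 in
  if odd j then if r == 0 then B y else (r == 2) && N y
  else if r == 0 then N (y + h.-1) else
       if r == 1 then N (y + h.-1) || B y else if r == 2 then B y else G y.

Let N_pred y : N (y.+1 + h.-1) = N y.
Proof. by rewrite addSnnS prednK. Qed.

Let low_white r y : low r y.+1.*2 = if r == 0 then N y else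
  if r == 1 then N y || B y.+1 else if r == 2 then B y.+1 else G y.+1.
Proof. by rewrite /low odd_double doubleK N_pred. Qed.

Let low_black r y : low r y.*2.+1 = if r == 0 then B y else (r == 2) && N y.
Proof. by rewrite /low /= odd_double uphalf_double. Qed.

Let low_h r j : low r (j + h.*2) = low r j.
Proof.
have e : (j + h.*2)./2 = j./2 + h by lia.
by rewrite /low e oddD odd_double addbF addnAC !N_h !B_h !G_h.
Qed.

Let low_disjoint r j : 0 < j -> low r j -> ~~ low r j.+1.
Proof.
have G1 y : G y -> G y.+1 = false by move=> Gy; apply: notG Gy _; lia.
have NG y : N y -> G y by case/andP.
have BG y : B y -> G y by case/andP.
have BN y : B y -> N y = false by rewrite /N => ->; rewrite andbF.
case: j => // j _; have [oj|ej] := boolP (odd j); last first.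
  have -> : j = j./2.*2 by rewrite even_halfK.
  move: j./2 => y; rewrite low_black -doubleS low_white.
  case: r => [|[|[|r]]] //= H; first by rewrite BN.
  by rewrite G_B // G1 // NG.
have -> : j.+1 = j./2.+1.*2 by rewrite doubleS -[j in LHS]odd_double_half oj.
move: j./2 => y; rewrite low_black low_white.
case: r => [|[|[|r]]] //= H; last by rewrite BN.
by rewrite G_B // G1 // NG.
Qed.

Let low_cross r y : r.+1 < m ->
  low r y.*2.+3 || low r y.*2.+2 = low r.+1 y.*2.+2 || low r.+1 y.*2.+1.
Proof.
rewrite -[y.*2.+3]/(y.+1.*2.+1) -[y.*2.+2]/(y.+1.*2) !low_white !low_black /=.
by case: r => [|[|[|r]]] //= _; rewrite ?orbF // orbC ?NB // orbF.
Qed.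

(** Closing up the torus shifts strand indices by [q], a multiple of [g], so the strands match. *)
Let low_cross_last y :
  low w.+2 y.*2.+3 || low w.+2 y.*2.+2
    = low 0 (y + c).*2.+2 || low 0 (y + c).*2.+1.
Proof.
rewrite -[y.*2.+3]/(y.+1.*2.+1) -[y.*2.+2]/(y.+1.*2).
rewrite -[(y + c).*2.+2]/((y + c).+1.*2) !low_white !low_black /= NB.
have -> : G (y + c) = G y.+1 by rewrite /G /c q_sg addnS -addSn dvdn_addl //
  dvdn_mull.
by case: w => [|w'] //=; rewrite ?orbF // orbC NB.
Qed.

Let blackP a b : odd b -> exists i y, i < m /\ pos a b = pos i y.*2.+3.
Proof.
move=> ob; set b' := b + (a %/ m * c).*2.
have ob' : odd b' by rewrite oddD odd_double addbF.
exists (a %% m), (b'./2 + h).-1; split; first exact: ltn_pmod.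
have -> : (b'./2 + h).-1.*2.+3 = b' + h.*2 by move: b' ob' h_gt0; lia.
by rewrite (pos_addh hc order_v0) -(pos_addmM hc m_c) addnC -divn_eq.
Qed.

Lemma hamiltonian_of_spaced : exists c,
  hamiltonian_cycle (honeycomb_adj U U' X) c.
Proof.
(* The column index is reduced below [m], each turn around the torus being paid for by a rise of
   [c.*2]. *)
have [||P PE] := @descend _ (fun i j => low (i %% m) (j + (i %/ m * c).*2)).
- by move=> i j; rewrite addnAC low_h.
- move=> i j; rewrite modnDr divnDr // divnn m_gt0 addn1 mulSn doubleD.
  by rewrite addnA.
have PEm i j : i < m -> P (pos i j) = low i j.
  by move=> li; rewrite PE modn_small // divn_small // addn0.
have P_disj v : P v -> ~~ P (U v).
  have [i [j [li ->]]] := surj v; rewrite -(pos_addh hc order_v0) pos_U.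
  by rewrite !PEm //; apply: low_disjoint;
    rewrite addn_gt0 double_gt0 h_gt0 orbT.
pose ends v := P v || P (U' v).
have endsE i j : ends (pos i j.+1) = P (pos i j.+1) || P (pos i j).
  by rewrite /ends -pos_U UK.
have ends_black i y : i < m -> ends (X (pos i y.*2.+3)) = ends (pos i y.*2.+3).
  move=> li; rewrite (pos_Xblack hc _ _ y.+1) doubleS !endsE !(PEm i) //.
  have [lt|ge] := ltnP i.+1 m; first by rewrite !PEm // low_cross.
  have ei : i = w.+2 by move: li ge; rewrite /m; lia.
  rewrite ei -[w.+3]add0n !posm !PEm // low_cross_last.
  by congr (low _ _ || low _ _); rewrite !addSn -doubleD.
have P_X v : ends v -> ends (X v).
  suff -> : ends (X v) = ends v by [].
  have [i [j ->]] := surjS v; have [ej|oj] := boolP (odd j); last first.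
    by have [i' [y [li' ->]]] := blackP i.+1 (oj : odd j.+1); exact: ends_black.
  rewrite -[pos i.+1 j.+1 in RHS]XK (pos_XS hc); last by rewrite /= negbK.
  have [|i' [y [li' ->]]] := @blackP i j.+2; first by rewrite /= negbK.
  by rewrite ends_black.
apply: (hamiltonian_of_strands hc P_disj P_X); first by apply/card_gt0P;
  exists v0.
set R := connect _.
have Rsym : connect_sym (opened U U' X P) by exact: (opened_csym hc).
have RS x y : R x y -> R y x by rewrite /R Rsym.
have run i j1 j2 : i < m -> j1 <= j2 ->
    (forall j, j1 <= j < j2 -> ~~ low i j) -> R (pos i j1) (pos i j2).
  move=> li le H; rewrite -(subnK le) -iter_pos; apply: opened_climb => n ln.
  by rewrite iter_pos PEm //; apply: H; lia.
have cross_low i y : i < m -> low i y.*2 -> R (pos i y.*2.+1) (pos i.+1 y.*2).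
  move=> li L; rewrite -pos_U -(pos_Xblack hc) -pos_U.
  by apply: (opened_crossU hc); rewrite PEm.
have cross_up i y : i < m -> low i y.*2.+1 -> R (pos i y.*2.+1) (pos i.+1 y.*2).
  by move=> li L; rewrite -(pos_Xblack hc); apply: opened_cross; rewrite PEm ?L.
have cross_white i y : i.+1 < m -> low i.+1 y.*2 ->
  R (pos i y.*2.+1) (pos i.+1 y.*2).
  move=> li L; apply: RS; rewrite -(pos_Xwhite hc).
  by apply: opened_cross; rewrite PEm ?L.
have runs i j1 j2 : i < m -> 0 < j1 <= j2 ->
    (forall y, j1 <= y.+1.*2 < j2 -> low i y.+1.*2 = false) ->
    (forall y, j1 <= y.*2.+1 < j2 -> low i y.*2.+1 = false) ->
    R (pos i j1) (pos i j2).
  move=> li /andP [p1 le] Hw Hb; apply: run => // j lj; apply/negbT.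
  have [oj|ej] := boolP (odd j).
    have E : j = j./2.*2.+1 by rewrite -[LHS]odd_double_half oj.
    by rewrite E; apply: Hb; rewrite -E.
  have E : j = j./2.-1.+1.*2 by move: p1 ej lj; lia.
  by rewrite E; apply: Hw; rewrite -E.
have NF y : B y -> N y = false by rewrite /N => ->; rewrite andbF.
have BF y : N y -> B y = false by case/andP=> _ /negPf.
have NG y : N y -> G y by case/andP.
have BG y : B y -> G y by case/andP.
have Gpred y : G y.+1 -> G y = false.
  move=> G1; apply/negP => G0; have : G y.+1 = false by apply: notG G0 _; lia.
  by rewrite G1.
have B0 y y' : G y -> y < y' < y + g -> B y' = false by move=>
  Gy /(notG Gy) /G_B.
have N0 y y' : G y -> y < y' < y + g -> N y' = false by move=>
  Gy /(notG Gy) /G_N.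
have B1 y y' : G y -> B (y + g) = false -> y < y' <= y + g -> B y' = false.
  move=> Gy By /andP [l1]; rewrite leq_eqVlt => /orP [/eqP -> //|l2].
  by apply: B0 Gy _; rewrite l1 l2.
have N1 y y' : B y -> y <= y' < y + g -> N y' = false.
  move=> By /andP []; rewrite leq_eqVlt => /orP [/eqP <- _|l1 l2];
    first exact: NF.
  by apply: N0 (BG _ By) _; rewrite l1 l2.
have m0 : 0 < m by []. have m1 : 1 < m by []. have m2 : 2 < m by [].
have run_c y : G y -> B (y + g) = false ->
    R (pos 0 y.+1.*2.+1) (pos 0 (y + g).+1.*2).
  move=> Gy By; apply: (runs _ _ _ m0) => [|y' ly|y' ly]; first by lia.
    by rewrite low_white /= (N0 y) //; lia.
  by rewrite low_black /= (B1 y) //; lia.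
have run_d y : 0 < y -> N y -> R (pos 1 y.*2) (pos 1 y.+1.*2).
  move=> y0 Ny; apply: (runs _ _ _ m1) => [|y' ly|y' ly]; first by lia.
    have ey : y = y'.+1 by lia.
    by rewrite low_white /= -ey BF // orbF G_N // Gpred // -ey NG.
  by rewrite low_black.
have run_e y : G y -> R (pos 1 y.+1.*2.+1) (pos 1 (y + g).*2).
  move=> Gy; apply: (runs _ _ _ m1) => [|y' ly|y' ly]; first by lia.
    by rewrite low_white /= (N0 y) ?(B0 y) //; lia.
  by rewrite low_black.
have run_e' y : B y -> R (pos 1 y.*2.+1) (pos 1 (y + g).*2).
  move=> By; have Gy := BG _ By; apply: (runs _ _ _ m1) => [|y' ly|y' ly];
    first by lia.
    by rewrite low_white /= (N1 _ y' By) ?(B0 y) //; lia.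
  by rewrite low_black.
have run_f y : G y -> B (y + g) = false ->
    R (pos 2 y.+1.*2) (pos 2 (y + g).*2.+1).
  move=> Gy By; apply: (runs _ _ _ m2) => [|y' ly|y' ly]; first by lia.
    by rewrite low_white /= (B1 y) //; lia.
  by rewrite low_black /= (N0 y) //; lia.
have run_g0 y : G y -> R (pos 0 y.+1.*2.+1) (pos 0 (y + g).*2.+1).
  move=> Gy; apply: (runs _ _ _ m0) => [|y' ly|y' ly]; first by lia.
    by rewrite low_white /= (N0 y) //; lia.
  by rewrite low_black /= (B0 y) //; lia.
have run_g2 y : G y -> R (pos 2 y.+1.*2) (pos 2 (y + g).*2).
  move=> Gy; apply: (runs _ _ _ m2) => [|y' ly|y' ly]; first by lia.
    by rewrite low_white /= (B0 y) //; lia.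
  by rewrite low_black /= (N0 y) //; lia.
have run_a y : B y -> B (y + g) = false ->
  R (pos 0 y.+1.*2) (pos 0 (y + g).+1.*2).
  move=> By By'; have Gy := BG _ By; apply: (runs _ _ _ m0) => [|y' ly|y' ly];
    first by lia.
    by rewrite low_white /= (N1 y) //; lia.
  by rewrite low_black /= (B1 y) //; lia.
have run_b y : B y -> B (y + g) = false ->
  R (pos 2 y.*2.+1) (pos 2 (y + g).*2.+1).
  move=> By By'; have Gy := BG _ By; apply: (runs _ _ _ m2) => [|y' ly|y' ly];
    first by lia.
    by rewrite low_white /= (B1 y) //; lia.
  by rewrite low_black /= (N1 y) //; lia.
have run_h i y : G y -> 2 < i < m -> R (pos i y.*2.+1) (pos i (y + g).*2).
  case: i => [|[|[|i]]] // Gy li; apply: (runs _ _ _ li) => [|y' ly|y' ly];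
    first by lia.
    by rewrite low_white /= (notG Gy) //; lia.
  by rewrite low_black.
(* The summand [k] leaves the strand unchanged modulo [h] and keeps heights positive. *)
pose Y j := (j + k) * g.
have YS j : Y j.+1 = Y j + g by rewrite /Y addSn mulSnr.
have Y_gt0 j : 0 < Y j by rewrite /Y muln_gt0 g_gt0 addn_gt0 (odd_gt0 odd_k)
  orbT.
have GY j : G (Y j) by rewrite /G dvdn_mull.
have BY j : B (Y j) = bent k w s j by rewrite /B GY mulnK // bent_k.
have NY j : N (Y j) = ~~ bent k w s j by rewrite /N GY BY.
have Yk j n : Y (j + n * k) = Y j + n * h by rewrite /Y h_kg; lia.
have posY i j y n : pos i (Y (j + n * k) + y).*2 = pos i (Y j + y).*2.
  by rewrite Yk addnAC posh.
have bent_next j : bent k w s j -> ~~ bent k w s j.+1.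
  by apply: bent_isolated odd_k _.
(* Each column crossed beyond column 3 lowers the strand index by one, which produces the shift
   [w]. *)
have chain j n : n <= w ->
    R (pos 3 (Y (j + w)).*2) (pos n.+3 (Y (j + (w - n))).*2).
  elim: n => [|n IH] ln; first by rewrite subn0; exact: connect0.
  apply: connect_chain (IH (ltnW ln)) _.
  have -> : w - n = (w - n.+1).+1 by lia.
  rewrite addnS YS; apply: connect_chain (RS _ _ (run_h _ _ (GY _) _)) _ => //.
  by apply: cross_low => //; rewrite -(prednK (Y_gt0 _)) low_white /= prednK.
have Rchain j : R (pos 3 (Y (j + w)).*2) (pos 0 (Y (j + s)).+1.*2).
  have := chain j w (leqnn w); rewrite subnn addn0 -[w.+3]add0n posm -doubleD.
  by have -> : Y j + c = (Y (j + s)).+1 by rewrite /Y /c q_sg; lia.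
have periodic i y j : pos i (Y (j + k) + y).*2 = pos i (Y j + y).*2.
  by rewrite -(posY i j y 1) mul1n.
have periodic0 i j : pos i (Y (j + k)).*2 = pos i (Y j).*2.
  by have := periodic i 0 j; rewrite !addn0.
have [||||||ll rl al] := @strips_connected T R (@connect0 _ _) RS
  (fun y x z => @connect_chain _ _ x y z) k w s
  (fun j => pos 0 (Y j).+1.*2) (fun j => pos 1 (Y j).*2)
  (fun j => pos 2 (Y j).*2.+1) _ _ _ odd_k.
- by move=> j; have := periodic 0 1 j; rewrite !addn1.
- by move=> j; exact: periodic0.
- by move=> j; rewrite -!pos_U periodic0.
- move=> j; rewrite -!NY !YS => N_j N_j1; have Gj := GY j.
  have BF1 : B (Y j + g) = false by exact: BF.
  split.
    apply: connect_chain (RS _ _ (run_c _ Gj BF1)) _.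
    apply: connect_chain (cross_low 0 _ m0 _) _; first by rewrite low_white.
    exact: RS (run_d _ (Y_gt0 j) N_j).
  apply: connect_chain (RS _ _ (run_e _ Gj)) _.
  apply: connect_chain (cross_low 1 _ m1 _) (run_f _ Gj BF1).
  by rewrite low_white /= N_j.
- move=> j bj; have nb1 := bent_next _ bj; have nb0 : ~~ bent k w s j.
    by apply: contraL bj; exact: bent_next.
  move: bj nb0 nb1; rewrite -!NY -BY !YS => B_j N_j N_j2; have Gj := GY j.
  have BF2 := BF _ N_j2; have eY : Y j + g = (Y j + g).-1.+1 by lia.
  split.
  + apply: connect_chain (run_d _ (Y_gt0 j) N_j) _.
    apply: connect_chain (RS _ _ (cross_low 0 _ m0 _)) _;
      first by rewrite low_white.
    apply: connect_chain (run_g0 _ Gj) (cross_up 0 _ m0 _).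
    by rewrite low_black.
  + apply: connect_chain (RS _ _ (run_e _ Gj)) _.
    apply: connect_chain (cross_low 1 _ m1 _) _;
      first by rewrite low_white /= N_j.
    apply: connect_chain (run_g2 _ Gj) _.
    apply: connect_chain (RS _ _ (cross_white 1 _ m2 _)) (run_e' _ B_j).
    by rewrite eY low_white /= -eY.
  + exact: run_a.
  + exact: run_b.
- move=> j; apply: connect_chain _ (Rchain j); set z := Y (j + w).
  have Gz : G z by exact: GY.
  have ez : z = z.-1.+1 by rewrite prednK // Y_gt0.
  have := NB z; rewrite Gz => /orP [Nz|Bz].
    by apply: cross_up => //; rewrite low_black.
  by apply: cross_low => //; rewrite ez low_white /= -ez.
set z0 := pos 0 (Y 0).+1.*2.
have G_Y y : G y -> exists j, y + h = Y j.
  by move/dvdnP => [j ->]; exists j; rewrite h_kg /Y mulnDl.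
have high i j : i > 2 -> i < m -> R (pos i (Y j).*2) z0.
  case: i => [|[|[|n]]] // _ ln; have nw : n <= w by move: ln; rewrite /m; lia.
  have k1 : w <= w * k by rewrite leq_pmulr // (odd_gt0 odd_k).
  have [t et] : exists t, t + (w - n) = j + w * k by exists (j + w * k - (w -
    n)); lia.
  have <- : pos n.+3 (Y (j + w * k)).*2 = pos n.+3 (Y j).*2.
    by have := posY n.+3 j 0 w; rewrite !addn0.
  rewrite -et; apply: connect_chain (RS _ _ (chain t n nw)) _.
  exact: connect_chain (Rchain t) (ll _ 0).
have P_z0 q0 : P q0 -> R q0 z0.
  have [i [j [li ->]]] := surj q0; rewrite PEm //.
  have Gz y : G y -> pos 1 y.*2 = pos 1 (y + h).*2 by rewrite -(posh 1 y 1)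
    mul1n.
  have a_z0 y : G y -> R (pos 1 y.*2) z0.
    by move=> /[dup] /Gz -> /G_Y [t ->]; exact: al.
  have [oj|ej] := boolP (odd j).
    have -> : j = j./2.*2.+1 by rewrite -[LHS]odd_double_half oj.
    move: j./2 => y {oj}; rewrite low_black => /[dup] L.
    case: i li L => [|[|[|i]]] //= li L _.
      by apply: connect_chain (cross_up 0 y m0 _) (a_z0 y (BG _ L));
        rewrite low_black.
    have [t et] := G_Y _ (NG _ L).
    by rewrite -pos_U -(posh 2 y 1) mul1n et pos_U; exact: rl.
  rewrite -(pos_addh hc order_v0) -low_h.
  have -> : j + h.*2 = (j./2 + h).-1.+1.*2 by move: ej h_gt0; lia.
  move: (j./2 + h).-1 => y {ej}; rewrite low_white => /[dup] L.
  case: i li L => [|[|[|i]]] //= li L _.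
  - have [t et] := G_Y _ (NG _ L).
    by rewrite -(posh 0 y.+1 1) mul1n addSn et; exact: ll.
  - case/orP: L => [Ny|By]; last exact: a_z0 (BG _ By).
    case: (posnP y) Ny => [->|y0] Ny; last first.
      exact: connect_chain (RS _ _ (run_d _ y0 Ny)) (a_z0 y (NG _ Ny)).
    have N_h0 : N h by have := N_h 0; rewrite add0n => ->.
    rewrite -(posh 1 1 1) mul1n add1n.
    exact: connect_chain (RS _ _ (run_d _ h_gt0 N_h0)) (a_z0 h (NG _ N_h0)).
  - apply: connect_chain (RS _ _ (cross_white 1 _ m2 _)) _;
    first by rewrite low_white.
    apply: connect_chain (run_e' _ L) (a_z0 _ _).
    by rewrite /G dvdn_addl //; exact: BG.
  have [t et] := G_Y _ L.
  by rewrite -(posh i.+3 y.+1 1) mul1n et; exact: high.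
have hits i : i < m -> exists j, low i j.
  move=> li; have N0' : N (Y 0) by rewrite NY /bent mod0n.
  have eY : Y 0 = (Y 0).-1.+1 by rewrite prednK.
  case: i li => [|[|[|i]]] li.
  - by exists (Y 0).+1.*2; rewrite low_white.
  - by exists (Y 0).+1.*2; rewrite low_white /= N0'.
  - by exists (Y 0).*2.+1; rewrite low_black.
  by exists (Y 0).*2; rewrite eY low_white /= -eY.
have all_z0 v : R v z0.
  have [i [j [li ->]]] := surj v; have [j' Lj'] := hits i li.
  have le : j <= j * h.*2 by rewrite leq_pmulr // double_gt0.
  have Pn : P (iter (j' + j * h.*2 - j) U (pos i j)).
    rewrite iter_pos subnK ?(pos_addhM hc order_v0) ?PEm //.
    exact: leq_trans le (leq_addl _ _).
  have [q0 Pq Cq] := opened_reach U' X Pn.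
  exact: connect_chain Cq (P_z0 _ Pq).
by move=> x y; apply: connect_chain (all_z0 x) (RS _ _ (all_z0 y)).
Qed.

End Spaced.

Lemma hamiltonian_of_odd_torus :
  exists c, hamiltonian_cycle (honeycomb_adj U U' X) c.
Proof.
have g0 : 0 < gcdn q h by rewrite gcdn_gt0 q_gt0.
have [cop|ncop] := boolP (coprime q h); first exact: hamiltonian_of_coprime.
apply: (hamiltonian_of_spaced (g := gcdn q h) (k := h %/ gcdn q h)
  (s := q %/ gcdn q h)).
- by rewrite ltn_neqAle eq_sym g0 andbT.
- by rewrite divnK // dvdn_gcdr.
- by rewrite divnK // dvdn_gcdl.
Qed.

End OddTorus.

(** * Every honeycomb is Hamiltonian *)

Lemma hamiltonian_of_honeycomb (T : finType) (U U' X : T -> T) (v0 : T) :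
  honeycomb U U' X -> exists c, hamiltonian_cycle (honeycomb_adj U U' X) c.
Proof.
move=> hc; have Uinj := U_inj hc.
have [/existsP [v ov]|] := boolP [exists v, odd (order U v)].
  exact: hamiltonian_of_odd_column hc ov.
rewrite negb_exists => /forallP even_columns.
pose h := (order U v0)./2.
have order_v0 : order U v0 = h.*2 by rewrite even_halfK.
have h0 := h_gt0 order_v0.
have U2h t : iter (t * h).*2 U v0 = v0.
  rewrite doubleMr -order_v0 iterM.
  by elim: t => //= t ->; rewrite iter_order.
have iter_mod t : iter t.*2 U v0 = iter (t %% h).*2 U v0.
  by rewrite {1}(divn_eq t h) addnC doubleD iterD U2h.
pose meets i := [exists t : 'I_h, iter i (shift U X) v0 == iter t.*2 U v0].
have meetsP i t : iter i (shift U X) v0 = iter t.*2 U v0 -> meets i.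
  move=> E; apply/existsP; exists (Ordinal (ltn_pmod t h0)).
  by rewrite /= E iter_mod.
have ex_m : exists i, (0 < i) && meets i.
  exists #|T|`!; rewrite fact_gt0; apply: (meetsP _ 0).
  by rewrite iter_card_fact //; exact: shift_inj hc.
case: (ex_minnP ex_m) => m /andP [m_gt0 /existsP [t /eqP m_t]] mmin.
have m_min i t' : 0 < i -> iter i (shift U X) v0 = iter t'.*2 U v0 -> m <= i.
  by move=> i0 /meetsP mi; apply: mmin; rewrite i0.
have [odd_m|even_m] := boolP (odd m); last first.
  exact: (hamiltonian_of_even_width hc even_columns order_v0 m_gt0 m_t m_min).
have [odd_h|even_h] := boolP (odd h); last first.
  exact: (hamiltonian_of_even_height hc even_columns order_v0 m_gt0 m_t m_min
    odd_m).
have [m1|m1] := eqVneq m 1.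
  exact: (hamiltonian_of_width_one hc m_t m1).
have [w em] : exists w, m = w.+3 by exists (m - 3); move: odd_m m1; lia.
have h1 : h != 1.
  apply/eqP => h1; have := hc_free hc v0; rewrite /= !inE !negb_or.
  have : U v0 = U' v0.
    by apply: Uinj; rewrite (hc_U'K hc); have := U2h 1; rewrite h1.
  by move=> ->; rewrite eqxx !andbF.
rewrite em in odd_m m_t m_min.
(* The closing shift matters only modulo [h]; taking [t + h] instead of [t] makes [q] positive. *)
apply: (@hamiltonian_of_odd_torus _ _ _ _ hc even_columns v0 h w (t + h).-1)
  => //.
  rewrite prednK ?addn_gt0 ?h0 ?orbT // doubleD iterD m_t.
  by have := U2h 1; rewrite mul1n => ->.
lia.
Qed.

(** * Frames on a hexagonal surface *)

(* [ext y x z] stands for the vertex that follows y, x, z on the face through *)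
(* the corner y - x - z.                                                       *)
Record hexagonal (T : finType) (e : rel T) (ext : T -> T -> T -> T) : Prop :=
Hexagonal {
  ext_edge : forall y x z, e x y -> e x z -> y != z -> e z (ext y x z);
  ext_neq : forall y x z, e x y -> e x z -> y != z -> ext y x z != x;
  ext_rev : forall y x z, e x y -> e x z -> y != z -> ext (ext y x z) z x = y;
  ext_hex : forall y x z, e x y -> e x z -> y != z ->
    let t := ext y x z in let u := ext x z t in let v := ext z t u in
    [/\ ext z x y = v, ext x y v = u, ext y v u = t & uniq [:: y; x; z; t; u;
      v]] }.

Module FlagCalculus.

Section Flags.

Variables (T : finType) (e : rel T) (ext : T -> T -> T -> T).
Hypotheses (e_sym : symmetric e) (e_irr : irreflexive e) (e_cubic :
  cubic_graph e).
Hypothesis hex : hexagonal e ext.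

(* The three neighbours in (x, y, z, w) are read as the X-neighbour of x and    *)
(* its upper and lower neighbours in its column.  U and X move this frame along *)
(* the edges to z and y, V turns it upside down and R rotates it.               *)
Definition is_flag (f : T * T * T * T) : bool :=
  let: (x, y, z, w) := f in
  [&& e x y, e x z, e x w, y != z, y != w & z != w].

Definition flag := {f : T * T * T * T | is_flag f}.

Definition vx (f : flag) : T := (val f).1.1.1.
Definition n1 (f : flag) : T := (val f).1.1.2.
Definition n2 (f : flag) : T := (val f).1.2.
Definition n3 (f : flag) : T := (val f).2.

Lemma flagP (f : flag) :
  [/\ e (vx f) (n1 f), e (vx f) (n2 f), e (vx f) (n3 f) &
    [/\ n1 f != n2 f, n1 f != n3 f & n2 f != n3 f]].
Proof. by case: f => [[[[x y] z] w] /= /and5P [-> -> -> -> /andP [-> ->]]]. Qed.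

Lemma neighbours3 (f : flag) a : e (vx f) a ->
  [\/ a = n1 f, a = n2 f | a = n3 f].
Proof.
case: (flagP f) => e1 e2 e3 [d12 d13 d23] ea.
have sub : [set n1 f; n2 f; n3 f] \subset [set b | e (vx f) b].
  by apply/subsetP => b; rewrite !inE -orbA => /or3P [] /eqP ->.
have card3 : #|[set n1 f; n2 f; n3 f]| = 3.
  by rewrite -setUA cardsU1 cards2 !inE negb_or d12 d13 d23.
have /eqP E : [set n1 f; n2 f; n3 f] == [set b | e (vx f) b].
  by rewrite eqEcard sub card3 e_cubic.
have : a \in [set n1 f; n2 f; n3 f] by rewrite E inE.
by rewrite !inE -orbA => /or3P [] /eqP;
  [constructor 1|constructor 2|constructor 3].
Qed.

Lemma flag_eq (f g : flag) : vx f = vx g -> n1 f = n1 g -> n2 f = n2 g -> f = g.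
Proof.
move=> E0 E1 E2; have E3 : n3 f = n3 g.
  case: (flagP f) => _ _ e3 [_ d13 d23]; rewrite E0 in e3.
  by case: (neighbours3 e3) => // E;
    [rewrite E1 E eqxx in d13 | rewrite E2 E eqxx in d23].
apply: val_inj; move: E0 E1 E2 E3; rewrite /vx /n1 /n2 /n3.
by case: (val f) => [[[x y] z] w];
  case: (val g) => [[[x' y'] z'] w'] /= -> -> -> ->.
Qed.

Definition rawU (f : T * T * T * T) :=
  let: (x, y, z, w) := f in (z, ext w x z, ext y x z, x).
Definition rawU' (f : T * T * T * T) :=
  let: (x, y, z, w) := f in (w, ext z x w, x, ext y x w).
Definition rawX (f : T * T * T * T) :=
  let: (x, y, z, w) := f in (y, x, ext z x y, ext w x y).
Definition rawV (f : T * T * T * T) := let: (x, y, z, w) := f in (x, y, w, z).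
Definition rawR (f : T * T * T * T) := let: (x, y, z, w) := f in (x, z, w, y).

Lemma ext_inj y y' x z : e x y -> e x y' -> e x z -> y != z -> y' != z ->
  y != y' -> ext y x z != ext y' x z.
Proof.
move=> ey ey' ez yz yz' yy; apply: contra yy => /eqP E.
by rewrite -(ext_rev hex ey ez yz) E (ext_rev hex).
Qed.

Lemma flagU (f : flag) : is_flag (rawU (val f)).
Proof.
case: f => [[[[x y] z] w] /= /and5P [ey ez ew yz /andP [yw zw]]].
have wz : w != z by rewrite eq_sym.
have wy : w != y by rewrite eq_sym.
apply/and5P; split; rewrite ?(ext_edge hex) ?(ext_neq hex) //;
  first by rewrite e_sym.
exact: ext_inj.
Qed.

Lemma flagU' (f : flag) : is_flag (rawU' (val f)).
Proof.
case: f => [[[[x y] z] w] /= /and5P [ey ez ew yz /andP [yw zw]]].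
have zy : z != y by rewrite eq_sym.
apply/and5P; split; rewrite ?(ext_edge hex) ?(ext_neq hex) //;
  first by rewrite e_sym.
by rewrite ext_inj //= eq_sym (ext_neq hex).
Qed.

Lemma flagX (f : flag) : is_flag (rawX (val f)).
Proof.
case: f => [[[[x y] z] w] /= /and5P [ey ez ew yz /andP [yw zw]]].
have zy : z != y by rewrite eq_sym.
have wy : w != y by rewrite eq_sym.
apply/and5P; split; rewrite ?(ext_edge hex) //; first by rewrite e_sym.
  by rewrite eq_sym (ext_neq hex).
by rewrite eq_sym (ext_neq hex) // ext_inj.
Qed.

Lemma flagV (f : flag) : is_flag (rawV (val f)).
Proof.
case: f => [[[[x y] z] w] /= /and5P [-> -> -> -> /andP [-> zw]]].
by rewrite eq_sym zw.
Qed.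

Lemma flagR (f : flag) : is_flag (rawR (val f)).
Proof.
case: f => [[[[x y] z] w] /= /and5P [-> -> -> yz /andP [yw ->]]].
by rewrite eq_sym yz eq_sym yw.
Qed.

Definition U (f : flag) : flag := exist _ (rawU (val f)) (flagU f).
Definition U' (f : flag) : flag := exist _ (rawU' (val f)) (flagU' f).
Definition X (f : flag) : flag := exist _ (rawX (val f)) (flagX f).
Definition V (f : flag) : flag := exist _ (rawV (val f)) (flagV f).
Definition R (f : flag) : flag := exist _ (rawR (val f)) (flagR f).

Lemma vxX f : vx (X f) = n1 f. Proof. by case: f => [[[[x y] z] w] vf]. Qed.
Lemma vxU f : vx (U f) = n2 f. Proof. by case: f => [[[[x y] z] w] vf]. Qed.
Lemma vxU' f : vx (U' f) = n3 f. Proof. by case: f => [[[[x y] z] w] vf]. Qed.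

Lemma UK : cancel U U'.
Proof.
case=> [[[[x y] z] w] vf]; apply: val_inj => /=.
case/and5P: (vf) => ey ez ew yz /andP [yw zw].
by rewrite !(ext_rev hex) // eq_sym.
Qed.

Lemma U'K : cancel U' U.
Proof.
case=> [[[[x y] z] w] vf]; apply: val_inj => /=.
case/and5P: (vf) => ey ez ew yz /andP [yw zw].
by rewrite !(ext_rev hex).
Qed.

Lemma XK : involutive X.
Proof.
case=> [[[[x y] z] w] vf]; apply: val_inj => /=.
case/and5P: (vf) => ey ez ew yz /andP [yw zw].
by rewrite !(ext_rev hex) // eq_sym.
Qed.

Lemma VK : involutive V.
Proof. by case=> [[[[x y] z] w] vf]; apply: val_inj. Qed.

Lemma RK f : R (R (R f)) = f.
Proof. by case: f => [[[[x y] z] w] vf]; apply: val_inj. Qed.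

Lemma RVR f : R (V (R f)) = V f.
Proof. by case: f => [[[[x y] z] w] vf]; apply: val_inj. Qed.

Lemma VUV f : V (U (V f)) = U' f.
Proof. by case: f => [[[[x y] z] w] vf]; apply: val_inj. Qed.

Lemma VX f : V (X f) = X (V f).
Proof. by case: f => [[[[x y] z] w] vf]; apply: val_inj. Qed.

Lemma UUX f : U (U (X f)) = X (U (U f)).
Proof.
case: f => [[[[x y] z] w] vf].
case/and5P: (vf) => ey ez ew yz /andP [yw zw].
case: (ext_hex hex ey ez yz) => /= E1 E2 E3 _.
by apply: (can_inj VK); apply: flag_eq; rewrite /vx /n1 /n2 /= E1 ?E2 ?E3.
Qed.

(* The point reflections in the midpoints of the three edges at a flag: they  *)
(* carry a frame to a neighbouring vertex parallelly up to sign.              *)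
Definition T1 f := X (V f).
Definition T2 f := V (U f).
Definition T3 f := U (V f).

Lemma T1K : involutive T1. Proof. by move=> f; rewrite /T1 VX XK VK. Qed.
Lemma T2K : involutive T2.
Proof. by move=> f; rewrite /T2 VUV UK. Qed.
Lemma T3K : involutive T3.
Proof. by move=> f; rewrite /T3 VUV U'K. Qed.

Lemma T1R f : T1 (R f) = R (T2 f).
Proof. by case: f => [[[[x y] z] w] vf]; apply: val_inj. Qed.
Lemma T2R f : T2 (R f) = R (T3 f).
Proof. by case: f => [[[[x y] z] w] vf]; apply: val_inj. Qed.
Lemma T3R f : T3 (R f) = R (T1 f).
Proof. by case: f => [[[[x y] z] w] vf]; apply: val_inj. Qed.
Lemma T1V f : T1 (V f) = V (T1 f). Proof. by rewrite /T1 VX. Qed.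
Lemma T2V f : T2 (V f) = V (T3 f). Proof. by []. Qed.
Lemma T3V f : T3 (V f) = V (T2 f). Proof. by rewrite /T3 /T2 !VK. Qed.

(** The hexagon relation: the product of three point reflections is again an involution. *)
Lemma T132 f : T1 (T3 (T2 f)) = T2 (T3 (T1 f)).
Proof. by rewrite /T1 /T2 /T3 VK (VX (V f)) VK UUX VX. Qed.

(** * Parallel frames and holonomy *)

Definition par_step : rel flag := fun f g =>
  [|| g == T1 f, g == T2 f | g == T3 f].
Definition par := connect par_step.

Lemma par_csym : connect_sym par_step.
Proof.
apply: sym_connect_sym => f g; rewrite /par_step.
by rewrite -(can2_eq T1K T1K) -(can2_eq T2K T2K) -(can2_eq T3K T3K) !(eq_sym f).
Qed.

Lemma par_sym f g : par f g -> par g f.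
Proof. by rewrite /par par_csym. Qed.

Lemma par_morph (h : flag -> flag) :
  (forall f g, par_step f g -> par_step (h f) (h g)) ->
  forall f g, par f g -> par (h f) (h g).
Proof.
move=> hP f g; apply: (connect_ind (S := fun g => par (h f) (h g))).
  exact: connect0.
by move=> u v Pu /hP Suv; apply: connect_trans Pu (connect1 Suv).
Qed.

Lemma par_R f g : par f g -> par (R f) (R g).
Proof.
apply: par_morph => {}f {}g; rewrite /par_step T1R T2R T3R.
by case/or3P=> /eqP ->; rewrite eqxx ?orbT.
Qed.

Lemma par_V f g : par f g -> par (V f) (V g).
Proof.
apply: par_morph => {}f {}g; rewrite /par_step T1V T2V T3V.
by case/or3P=> /eqP ->; rewrite eqxx ?orbT.
Qed.

(** Products of two point reflections, which are translations of the covering plane; [par] allows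
    half-turns as well. *)
Definition trans_step : rel flag := fun f g =>
  [|| g == T1 (T2 f), g == T2 (T1 f), g == T1 (T3 f), g == T3 (T1 f),
      g == T2 (T3 f) | g == T3 (T2 f)].
Definition transl := connect trans_step.

Lemma trans_csym : connect_sym trans_step.
Proof.
apply: sym_connect_sym.
suff H f g : trans_step f g -> trans_step g f by move=> f g; apply/idP/idP;
  apply: H.
rewrite /trans_step.
by case/or4P=> [/eqP->|/eqP->|/eqP->|/or3P [] /eqP->];
  rewrite ?T1K ?T2K ?T3K ?T1K ?T2K eqxx ?orbT.
Qed.

Lemma transl_sym f g : transl f g -> transl g f.
Proof. by rewrite /transl trans_csym. Qed.

Lemma transl_morph (h : flag -> flag) :
  (forall f g, trans_step f g -> transl (h f) (h g)) ->
  forall f g, transl f g -> transl (h f) (h g).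
Proof.
move=> hP f g; apply: (connect_ind (S := fun g => transl (h f) (h g))).
  exact: connect0.
by move=> u v Pu /hP; apply: connect_trans Pu.
Qed.

Lemma transl_R f g : transl f g -> transl (R f) (R g).
Proof.
apply: transl_morph => {}f {}g sfg; apply: connect1; move: sfg.
rewrite /trans_step !(T1R, T2R, T3R).
by case/or4P=> [/eqP->|/eqP->|/eqP->|/or3P [] /eqP->]; rewrite eqxx ?orbT.
Qed.

Lemma transl_12 f : transl f (T1 (T2 f)).
Proof. by apply: connect1; rewrite /trans_step eqxx ?orbT. Qed.
Lemma transl_21 f : transl f (T2 (T1 f)).
Proof. by apply: connect1; rewrite /trans_step eqxx ?orbT. Qed.
Lemma transl_23 f : transl f (T2 (T3 f)).
Proof. by apply: connect1; rewrite /trans_step eqxx ?orbT. Qed.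
Lemma transl_32 f : transl f (T3 (T2 f)).
Proof. by apply: connect1; rewrite /trans_step eqxx ?orbT. Qed.

Lemma transl_T2 f g : transl f g -> transl (T2 f) (T2 g).
Proof.
have D1 u : transl (T2 u) (T1 u) by rewrite -{2}[u]T2K; exact: transl_12.
have D3 u : transl (T2 u) (T3 u) by rewrite -{2}[u]T2K; exact: transl_32.
apply: transl_morph => {}f {}g.
case/or4P=> [/eqP->|/eqP->|/eqP->|/or3P [] /eqP->]; rewrite ?T2K.
- exact: transl_21.
- exact: D1.
- exact: connect_trans (D3 _) (transl_21 _).
- exact: connect_trans (D1 _) (transl_23 _).
- exact: D3.
exact: transl_23.
Qed.

Local Notation N := (shift U X).
Let b f := U (U f).

Let NE f : N f = T1 (T2 f). Proof. by rewrite /shift /T1 /T2 VK. Qed.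
Let bE f : b f = T3 (T2 f). Proof. by rewrite /b /T3 /T2 VK. Qed.

Let N_inj : injective N.
Proof. by move=> f g; rewrite !NE => /(can_inj T1K) /(can_inj T2K). Qed.
Let b_inj : injective b.
Proof. by move=> f g; rewrite !bE => /(can_inj T3K) /(can_inj T2K). Qed.

Let bN f : b (N f) = N (b f).
Proof. by rewrite /b /shift UUX. Qed.

Let iter_bN j i f : iter j b (iter i N f) = iter i N (iter j b f).
Proof.
have E g : b (iter i N g) = iter i N (b g) by elim: i => //= i <-; rewrite bN.
by elim: j => //= j ->; rewrite E.
Qed.

(** [N] and [b] generate the translations and commute; finiteness turns their inverses into
    iterates, so natural exponents suffice. *)
Lemma translE f g : transl f g -> exists i j, g = iter j b (iter i N f).
Proof.
pose S g := exists i j, g = iter j b (iter i N f).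
have SN u : S u -> S (N u).
  by case=> i [j ->]; exists i.+1, j; rewrite iter_bN -iterS -iter_bN.
have Sb u : S u -> S (b u) by case=> i [j ->]; exists i, j.+1.
have Nc : cancel N (fun f => T2 (T1 f)) by move=> u; rewrite NE T1K T2K.
have Nc' : cancel (fun f => T2 (T1 f)) N by move=> u; rewrite NE T2K T1K.
have bc : cancel b (fun f => T2 (T3 f)) by move=> u; rewrite bE T3K T2K.
have bc' : cancel (fun f => T2 (T3 f)) b by move=> u; rewrite bE T2K T3K.
have SN' := closed_inverse Nc Nc' SN; have Sb' := closed_inverse bc bc' Sb.
apply: (connect_ind (S := S)); first by exists 0, 0.
move=> u v Su; case/or4P=> [/eqP->|/eqP->|/eqP->|/or3P [] /eqP->].
- by rewrite -NE; exact: SN.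
- exact: SN'.
- by rewrite -[T3 u]T2K -NE; apply/SN/Sb'.
- by rewrite -[T1 u]T2K -bE; apply/Sb/SN'.
- exact: Sb'.
by rewrite -bE; exact: Sb.
Qed.

Let vxN f : vx (N f) != vx f.
Proof.
case: f => [[[[x y] z] w] vf]; rewrite /vx /=.
case/and5P: (vf) => ey ez ew yz /andP [yw zw].
by rewrite (ext_neq hex) // eq_sym.
Qed.

Let n12 f : n1 f <> n2 f.
Proof. by case: (flagP f) => _ _ _ [/eqP]. Qed.

Let NRb f : N (R (b f)) = R f.
Proof. by rewrite NE bE T2R T1R T3K T2K. Qed.

Let NRN f : N (R (N f)) = b (R f).
Proof. by rewrite NE NE bE !T2R T1R !T3R -T132 T2K. Qed.

Let NRbN p q f : iter (p + q) N (R (iter q b (iter p N f))) = iter p b (R f).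
Proof.
rewrite iterD; have -> g : iter q N (R (iter q b g)) = R g.
  by elim: q => // q IH; rewrite iterSr [iter q.+1 b g]iterS NRb.
elim: p => // p IH; rewrite iterSr [iter p.+1 N f]iterS NRN.
by rewrite -[b (R _)]/(iter 1 b _) -iter_bN IH.
Qed.

Let perN n f : iter (n * #|{: flag}|`!) N f = f.
Proof. by rewrite iterM; elim: n => //= n ->; exact: iter_card_fact. Qed.

(* After a change of base point such a rotation would have its centre at a    *)
(* vertex or in a face at the base point, but faces have six vertices.        *)
Lemma no_rotation f : ~~ transl f (R f).
Proof.
apply/negP => /translE [i [j E]].
have [I [lI {}E]] : exists I, j * 4 + 4 <= I /\ R f = iter j b (iter I N f).
  exists (i + (j * 4 + 4) * #|{: flag}|`!); split.
    by have := fact_gt0 #|{: flag}|; nia.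
  by rewrite iterD perN.
have key p : p <= I ->
    let f' := iter (p + j) b (iter p N f) in
    iter (p + (p + j)) N (R f') = iter (I - p) N f'.
  move=> lp f'; rewrite NRbN E -iterD -iter_bN -iterD subnK //.
(* After moving the base point to [f'], the two exponents of [N] in [key] differ by [eps - 1]. For
   [eps = 1] the centre is the vertex itself, for 0 and 2 it is a face, two of whose vertices would
   coincide. *)
have [p0 [eps [lt3 eI]]] : exists p0 eps, eps < 3 /\ I - j + 1 = 3 * p0 + eps.
  exists ((I - j + 1) %/ 3), ((I - j + 1) %% 3); rewrite ltn_mod; split=> //.
  by rewrite mulnC -divn_eq.
have lp : p0 <= I by lia.
move: (key p0 lp) => /=; set f' := iter (p0 + j) b _.
case: eps lt3 eI => [|[|[|]]] // _ eI.
- have -> : p0 + (p0 + j) = (I - p0).+1 by lia.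
  rewrite iterSr => /(iter_inj N_inj) /(congr1 vx) E'.
  have := vxN (R f'); rewrite E' => /eqP; apply.
  by case: (f') => [[[[x y] z] w] vf].
- have -> : p0 + (p0 + j) = I - p0 by lia.
  move/(iter_inj N_inj)/(congr1 n1) => E'; apply: (@n12 f'); rewrite -E'.
  by case: (f') => [[[[x y] z] w] vf].
have -> : I - p0 = (p0 + (p0 + j)).+1 by lia.
rewrite iterSr => /(iter_inj N_inj) /(congr1 vx) E'.
have := vxN f'; rewrite -E' => /eqP; apply.
by case: (f') => [[[[x y] z] w] vf].
Qed.

Lemma par_transl f g : par f g -> transl f g \/ transl f (T2 g).
Proof.
apply: (connect_ind (S := fun g => transl f g \/ transl f (T2 g))).
  by left; exact: connect0.
move=> u v [Pu|Pu] st; [right|left]; apply: (connect_trans Pu).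
  case/or3P: st => /eqP ->; [exact: transl_21 | | exact: transl_23].
  by rewrite T2K; exact: connect0.
case/or3P: st => /eqP ->; last by have := transl_32 (T2 u); rewrite T2K.
  by have := transl_12 (T2 u); rewrite T2K.
exact: connect0.
Qed.

(** If [R f] were reached up to a half-turn, doing so twice would reach [R (R f)] by translations,
    and four times [R f]. *)
Lemma no_par_rotation f : ~~ par f (R f).
Proof.
apply/negP => /par_transl [|E]; first by apply/negP; exact: no_rotation.
have E2 : transl f (R (R f)).
  apply: (connect_trans E); apply: (connect_trans (transl_T2 (transl_R E))).
  by rewrite T2R; apply/transl_sym/transl_R; exact: transl_32.
have := transl_R (transl_R E2); rewrite RK => E4.
by have /negP := no_rotation f; apply; exact: connect_trans E2 E4.
Qed.

Lemma no_par_rotation2 f : ~~ par f (R (R f)).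
Proof.
apply/negP => E; have := par_R (par_R E); rewrite RK => E4.
by have /negP := no_par_rotation f; apply; exact: connect_trans E E4.
Qed.

(** The holonomy contains no reflection that would move the first edge to another class, so the
    first edges can serve as X-edges. *)
Definition no_slant f := ~~ par f (V (R f)) && ~~ par f (V (R (R f))).

Lemma no_slant_of_reflection f : par f (V f) -> no_slant f.
Proof.
move=> Pf; apply/andP; split; apply/negP => /par_V; rewrite VK => E.
  by have /negP := no_par_rotation f; apply; exact: connect_trans Pf E.
by have /negP := no_par_rotation2 f; apply; exact: connect_trans Pf E.
Qed.

Lemma RVRR f : R (V (R (R f))) = V (R f).
Proof. exact: RVR. Qed.

(** Two different reflections would compose to a rotation of order three. So at most one occurs, and
    a suitable [R]-turn of the frame makes it [V]. *)
Lemma ex_no_slant (f : flag) : exists f0, no_slant f0.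
Proof.
have [P1|n1] := boolP (par f (V (R f))).
  exists (R (R f)); apply: no_slant_of_reflection.
  have := par_R (par_R P1); rewrite RVR.
  by have -> : R (V f) = V (R (R f)) by case: (f) => [[[[x y] z] w] vf];
    apply: val_inj.
have [P2|n2] := boolP (par f (V (R (R f)))); last by exists f;
  rewrite /no_slant n1.
by exists (R f); apply: no_slant_of_reflection; have := par_R P2; rewrite RVRR.
Qed.

Lemma same_vertex f g : vx f = vx g ->
  [\/ g = f, g = V f, g = R f | g = R (R f) \/ g = V (R f) \/ g = V (R (R f))].
Proof.
case: (flagP f) (flagP g) => e1 e2 e3 [d12 d13 d23] [e1' e2' e3' [d12' d13'
  d23']] E.
rewrite -E in e1' e2' e3'.
have vR : vx (R f) = vx f /\ n1 (R f) = n2 f /\ n2 (R f) = n3 f /\ n3 (R f) =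
  n1 f.
  by case: (f) => [[[[x y] z] w] vf].
have vV h : vx (V h) = vx h /\ n1 (V h) = n1 h /\ n2 (V h) = n3 h /\ n3 (V h)
  = n2 h.
  by case: h => [[[[x y] z] w] vf].
have vRR : vx (R (R f)) = vx f /\ n1 (R (R f)) = n3 f /\ n2 (R (R f)) = n1 f
   /\ n3 (R (R f)) = n2 f.
  by case: (f) => [[[[x y] z] w] vf].
have eqg h : vx h = vx f -> n1 h = n1 g -> n2 h = n2 g -> g = h.
  by move=> E0 E1 E2; apply: flag_eq; rewrite ?E0 ?E1 ?E2.
have [V0 [V1 [V2 V3]]] := vV f.
have [R0 [R1 [R2 R3]]] := vR; have [RR0 [RR1 [RR2 RR3]]] := vRR.
have [VR0 [VR1 [VR2 VR3]]] := vV (R f).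
have [VRR0 [VRR1 [VRR2 VRR3]]] := vV (R (R f)).
case: (neighbours3 e1') => E1; case: (neighbours3 e2') => E2.
- by rewrite E1 E2 eqxx in d12'.
- by constructor 1; apply: eqg.
- by constructor 2; apply: eqg; rewrite ?V1 ?V2.
- by constructor 4; right; left; apply: eqg; rewrite ?VR0 ?VR1 ?VR2 ?R0 ?R1 ?R3.
- by rewrite E1 E2 eqxx in d12'.
- by constructor 3; apply: eqg; rewrite ?R1 ?R2.
- by constructor 4; left; apply: eqg; rewrite ?RR1 ?RR2.
- by constructor 4; right; right; apply: eqg;
  rewrite ?VRR0 ?VRR1 ?VRR2 ?RR0 ?RR1 ?RR3.
by rewrite E1 E2 eqxx in d12'.
Qed.

Definition frame_step : rel flag := fun f g => (g == U f) || (g == X f).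
Definition frame := connect frame_step.

Lemma frame_U f g : frame f g -> frame f (U g).
Proof.
by move=> fg; apply: connect_trans fg (connect1 _); rewrite /frame_step eqxx.
Qed.

Lemma frame_X f g : frame f g -> frame f (X g).
Proof.
by move=> fg; apply: connect_trans fg (connect1 _);
  rewrite /frame_step eqxx orbT.
Qed.

Lemma frame_U' f g : frame f g -> frame f (U' g).
Proof. by apply: (closed_inverse (S := fun g => frame f g) UK U'K) => u;
  exact: frame_U. Qed.

Lemma frame_ind (S : flag -> Prop) f : S f ->
  (forall u, S u -> S (U u)) -> (forall u, S u -> S (X u)) ->
  forall g, frame f g -> S g.
Proof.
move=> Sf SU SX g; apply: connect_ind Sf _ => u v Su.
by case/orP=> /eqP ->; [exact: SU | exact: SX].
Qed.

Lemma frame_sym f g : frame f g -> frame g f.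
Proof.
move: g; apply: frame_ind => [|u IH|u IH]; first exact: connect0.
- by apply: connect_trans IH; rewrite -{2}[u]UK; exact: frame_U' (connect0 _ _).
- by apply: connect_trans IH; rewrite -{2}[u]XK; exact: frame_X (connect0 _ _).
Qed.

Lemma frame_V f g : frame f g -> frame (V f) (V g).
Proof.
move: g; apply: frame_ind => [|u IH|u IH]; first exact: connect0.
- by rewrite -[u]VK -[U (V (V u))]VK VUV VK; exact: frame_U'.
- by rewrite VX; exact: frame_X.
Qed.

Lemma frame_par f g : frame f g -> par f g || par f (V g).
Proof.
have st1 u : par u (T1 u) by apply: connect1; rewrite /par_step eqxx.
have st2 u : par u (T2 u) by apply: connect1; rewrite /par_step eqxx orbT.
have st3 u : par u (T3 u) by apply: connect1; rewrite /par_step eqxx !orbT.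
move: g; apply: frame_ind => [|u IH|u IH]; first by rewrite /par connect0.
- case/orP: IH => P; apply/orP; [right | left]; apply: (connect_trans P).
    exact: st2.
  by have := st3 (V u); rewrite /T3 VK.
- case/orP: IH => P; apply/orP; [right | left]; apply: (connect_trans P).
    by have := st1 u; rewrite /T1 -VX.
  by have := st1 (V u); rewrite /T1 VK.
Qed.

Lemma RV f : R (V f) = V (R (R f)).
Proof. by case: (f) => [[[[x y] z] w] vf]; apply: val_inj. Qed.

Lemma no_slant_V f : no_slant f -> no_slant (V f).
Proof.
case/andP=> s1 s2; apply/andP; split; apply/negP => /par_V; rewrite !VK RV.
  exact/negP.
by rewrite RVR; exact/negP.
Qed.

Lemma no_slant_par f g : par f g -> no_slant f -> no_slant g.
Proof.
move=> fg /andP [s1 s2]; apply/andP; split.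
  apply: contra s1 => P; apply: (connect_trans fg (connect_trans P _)).
  exact: par_sym (par_V (par_R fg)).
apply: contra s2 => P; apply: (connect_trans fg (connect_trans P _)).
exact: par_sym (par_V (par_R (par_R fg))).
Qed.

(** Of the six frames at a vertex, rotations are excluded by the holonomy and slanted reflections by
    [no_slant]. *)
Lemma frame_fibre f0 f g : no_slant f0 -> frame f0 f -> frame f0 g ->
  vx f = vx g -> g = f \/ g = V f.
Proof.
move=> ns Ff Fg E.
have nsf : no_slant f.
  case/orP: (frame_par Ff) => P; first exact: no_slant_par P ns.
  by rewrite -[f]VK; apply: no_slant_V; exact: no_slant_par P ns.
have fg := frame_par (connect_trans (frame_sym Ff) Fg).
have /negP r1 := no_par_rotation f; have /negP r2 := no_par_rotation2 f.
case/andP: nsf => /negP s1 /negP s2.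
case: (same_vertex E) => [->|->|eg|[eg|[eg|eg]]]; [by left | by right | | | | ];
  by move: fg; rewrite eg ?VK => /orP [].
Qed.

Hypothesis e_conn : connected_graph e.

Lemma frame_onto f0 x : exists f, frame f0 f /\ vx f = x.
Proof.
have [_ conn] := e_conn.
apply: (connect_ind (r := e) (x := vx f0)
  (S := fun x => exists f, frame f0 f /\ vx f = x)) (conn _ x).
  by exists f0; split; first exact: connect0.
move=> u v [f [Ff <-]] /neighbours3 [] ->.
- by exists (X f); rewrite vxX; split; first exact: frame_X.
- by exists (U f); rewrite vxU; split; first exact: frame_U.
by exists (U' f); rewrite vxU'; split; first exact: frame_U'.
Qed.

(** The orbit of [f0] then contains one frame over each vertex, through which [U], [U'] and [X]
    descend to the graph. *)
Lemma hamiltonian_of_section f0 : no_slant f0 -> ~~ frame f0 (V f0) ->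
  exists c, hamiltonian_cycle e c.
Proof.
move=> ns nV.
have inj f g : frame f0 f -> frame f0 g -> vx f = vx g -> g = f.
  move=> Ff Fg E; case: (frame_fibre ns Ff Fg E) => // eg.
  case/negP: nV; apply: (connect_trans Fg); rewrite eg.
  exact/frame_V/frame_sym.
have [fr frP] := fin_all_exists (frame_onto f0).
have frF x := (frP x).1; have vfr x := (frP x).2.
pose uT x := vx (U (fr x)); pose uT' x := vx (U' (fr x));
  pose xT x := vx (X (fr x)).
have frU x : fr (uT x) = U (fr x).
  by apply: inj; rewrite ?vfr //; exact: frame_U.
have frU' x : fr (uT' x) = U' (fr x).
  by apply: inj; rewrite ?vfr //; exact: frame_U'.
have frX x : fr (xT x) = X (fr x).
  by apply: inj; rewrite ?vfr //; exact: frame_X.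
have frv f : frame f0 f -> fr (vx f) = f by move=> Ff; apply: inj; rewrite ?vfr.
have hc : honeycomb uT uT' xT.
  split.
  - by move=> x; rewrite {1}/uT' frU UK vfr.
  - by move=> x; rewrite {1}/uT frU' U'K vfr.
  - by move=> x; rewrite {1}/xT frX XK vfr.
  - by move=> x; rewrite {1}/uT frU frX {1}/xT frU frU UUX.
  - move=> x; rewrite -{1}[x]vfr /uT /uT' /xT vxU vxU' vxX.
    case: (flagP (fr x)) => e1 e2 e3 [d12 d13 d23].
    have ne a : e (vx (fr x)) a -> vx (fr x) != a.
      by apply: contraTneq => ->; rewrite e_irr.
    by rewrite /= !inE !negb_or !ne // d12 d13 d23.
  move=> x S Sx SU SX y; rewrite -[y]vfr; have : frame (fr x) (fr y).
    by apply: connect_trans (frame_sym (frF x)) (frF y).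
  suff H g : frame (fr x) g -> frame f0 g /\ S (vx g) by case/H.
  move: g; apply: frame_ind; first by rewrite vfr.
    move=> u [Fu Su]; split; first exact: frame_U.
    by have := SU _ Su; rewrite /uT frv.
  move=> u [Fu Su]; split; first exact: frame_X.
  by have := SX _ Su; rewrite /xT frv.
have [c hamc] := hamiltonian_of_honeycomb (vx f0) hc.
exists c; apply: hamiltonian_cycle_sub hamc => v w.
rewrite -[in e v w](vfr v) /honeycomb_adj /uT /uT' /xT vxU vxU' vxX.
by case: (flagP (fr v)) => e1 e2 e3 _; case/or3P=> /eqP ->.
Qed.

(** Up to translation the centre is a face or the midpoint of an edge of one of three classes,
    according to the parities of [i] and [j]. A vertex would be identified with its opposite on a
    face or with a neighbour. *)
Lemma no_half_turn f : ~~ transl f (T2 f).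
Proof.
apply/negP => /translE [i [j E]].
have NTN p g : iter p N (T2 (iter p N g)) = T2 g.
  by elim: p => // p IH; rewrite iterSr [iter p.+1 N g]iterS !NE T2K T1K.
have bTb p g : iter p b (T2 (iter p b g)) = T2 g.
  by elim: p => // p IH; rewrite iterSr [iter p.+1 b g]iterS !bE T2K T3K.
pose f' := iter j./2 b (iter i./2 N f).
have {}E : T2 f' = iter (odd j) b (iter (odd i) N f').
  apply: (iter_inj b_inj (n := j./2)); apply: (iter_inj N_inj (n := i./2)).
  rewrite bTb NTN E /f' -!iter_bN -!iterD.
  by congr (iter _ b (iter _ N f)); lia.
have vT2 g : vx (T2 g) = n2 g by case: g => [[[[x y] z] w] vf].
case: (f') (vT2 f') E => [[[[x y] z] w] vf] /= vT2f' /(congr1 vx).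
case/and5P: (vf) => ey ez ew yz /andP [yw zw].
rewrite vT2f'; case: (odd j); case: (odd i); rewrite /n2 /vx /=.
- have wz : w != z by rewrite eq_sym.
  have wy : w != y by rewrite eq_sym.
  have := ext_hex hex (ext_edge hex ew ez wz) (ext_edge hex ey ez yz) (ext_inj
    ew ey ez wz yz wy).
  case=> /= -> -> _ U6 ez'; move: U6; rewrite -ez' !inE eqxx.
  by rewrite !orbT !andbF.
- by move=> ez'; have := ext_edge hex ey ez yz; rewrite -ez' e_irr.
- by move=> ez'; have := ext_edge hex ew ez;
  rewrite -ez' e_irr eq_sym zw => /(_ isT).
by move=> ez'; rewrite ez' e_irr in ez.
Qed.

Lemma transl_V f g : transl f g -> transl (V f) (V g).
Proof.
apply: transl_morph => {}f {}g sfg; apply: connect1; move: sfg.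
rewrite /trans_step !(T1V, T2V, T3V).
by case/or4P=> [/eqP->|/eqP->|/eqP->|/or3P [] /eqP->]; rewrite eqxx ?orbT.
Qed.

Lemma frame_transl f g : frame f g -> transl f g \/ transl f (U' g).
Proof.
move: g; apply: frame_ind => [|u|u]; first by left; exact: connect0.
  case=> P; [right | left]; first by rewrite UK.
  by apply: (connect_trans P); have := transl_32 (U' u); rewrite -bE /b U'K.
case=> P; [right | left]; apply: (connect_trans P).
  by have := transl_21 u; rewrite /T2 /T1 -VX VUV.
by have := transl_12 (U' u); rewrite -NE /shift U'K.
Qed.

Let UV u : U (V u) = V (U' u). Proof. by rewrite -VUV VK. Qed.

Let bVb y g : iter y b (V (iter y b g)) = V g.
Proof.
have b1 u : b (V (b u)) = V u by rewrite /b !UV !UK.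
by elim: y => // y IH; rewrite iterSr [iter y.+1 b g]iterS b1.
Qed.

(* A glide reversing the columns: the surface is a Klein bottle whose glide    *)
(* axis is orthogonal to the columns.                                          *)
Section Reflected.

Variables (f0 : flag) (h m j : nat).
Hypothesis ns : no_slant f0.
Hypothesis h_gt0 : 0 < h.
Hypothesis h_per : iter h b f0 = f0.
Hypothesis h_min : forall y z, iter y b f0 = iter z b f0 -> y = z %[mod h].
Hypothesis V_f0 : transl f0 (V f0).
Hypothesis m_gt0 : 0 < m.
Hypothesis m_j : iter m N f0 = V (iter j b f0).
Hypothesis m_min : forall i s t, 0 < i ->
  iter s b (iter i N f0) = V (iter t b f0) -> m <= i.

Let iterU2 y g : iter y.*2 U g = iter y b g.
Proof. by elim: y => //= y ->. Qed.

Let G i s := iter s U (iter i N f0).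

Let GU i s : G i s.+1 = U (G i s). Proof. by []. Qed.

Let G_even i y : G i y.*2 = iter y b (iter i N f0). Proof. exact: iterU2. Qed.

Let G_odd i y : G i y.*2.+1 = U (iter y b (iter i N f0)).
Proof. by rewrite GU G_even. Qed.

Let G_per i s : G i (s + h.*2) = G i s.
Proof. by rewrite /G iterD iterU2 iter_bN h_per. Qed.

Let G_X i y : X (G i y.*2.+1) = G i.+1 y.*2.
Proof. by rewrite G_odd G_even [RHS]iter_bN iterS -iter_bN. Qed.

Let G_frame i s : frame f0 (G i s).
Proof.
rewrite /G; elim: s => [|s IH] /=; last exact: frame_U.
elim: i => [|i IH] /=; first exact: connect0.
exact/frame_X/frame_U.
Qed.

Let transl_bN i y g : transl g (iter y b (iter i N g)).
Proof.
elim: y => [|y IH] /=; last first.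
  by apply: (connect_trans IH); rewrite bE; exact: transl_32.
elim: i => [|i IH] /=; first exact: connect0.
by apply: (connect_trans IH); rewrite NE; exact: transl_12.
Qed.

Let NV i g : iter i N (V g) = iter i b (V (iter i N g)).
Proof.
have NV1 u : N (V u) = b (V (N u)).
  rewrite /shift /b !UV -VX; congr V.
  by apply: (can_inj UK); apply: (can_inj UK); rewrite UUX !U'K.
elim: i => // i IH; rewrite [LHS]iterS IH -[N _]/(iter 1 N _) -iter_bN /= NV1.
by rewrite -iterSr.
Qed.

Let h_perM n : iter (n * h) b f0 = f0.
Proof. by elim: n => // n IH; rewrite mulSn iterD IH. Qed.

Let bV_shift r y z :
  exists z', iter y b (V (iter z b (iter r N f0))) = V (iter z' b (iter r N
    f0)).
Proof.
exists (z + h.-1 * y); rewrite -[RHS](bVb y) -iterD.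
have -> : y + (z + h.-1 * y) = z + y * h by nia.
by rewrite iterD (iter_bN (y * h)) h_perM.
Qed.

Let V_neq y z : V (iter y b f0) <> iter z b f0.
Proof.
have Vneq u : V u <> u.
  move=> /(congr1 n2); case: (flagP u) => _ _ _ [_ _ /eqP d23] E; apply: d23.
  by rewrite -E; case: (u) => [[[[? ?] ?] ?] ?].
have Vneqb u : V u <> b u.
  case: u => [[[[x y'] z'] w] vf] /(congr1 vx); rewrite /vx /= => E.
  case/and5P: (vf) => ey ez ew yz /andP [yw zw].
  by have := ext_neq hex ey ez yz; rewrite -E eqxx.
move=> E; have [d ed] : exists d, iter z b f0 = iter (y + d) b f0.
  by exists (z + y * h.-1); rewrite addnCA -mulnS prednK // iterD h_perM.
set u := iter d./2 b (iter y b f0).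
have e2 : iter (y + d) b f0 = iter d./2 b (iter (odd d) b u).
  by rewrite /u -!iterD; congr iter; lia.
have := bVb d./2 (iter y b f0); rewrite E ed e2 => /(iter_inj b_inj).
by case: (odd d); [exact: Vneqb | exact: Vneq].
Qed.

Let no_cycle r s t : 0 < r < m -> iter s b (iter r N f0) <> iter t b f0.
Proof.
case/andP=> r0 rm /(congr1 (iter (m - r) N)).
rewrite -!iter_bN -iterD subnK ?(ltnW rm) // m_j.
have [z /= ->] := bV_shift 0 s j; move/esym/m_min.
by rewrite subn_gt0 rm => /(_ isT); lia.
Qed.

Let no_half h' : transl f0 h' -> ~~ transl f0 (V (U h')).
Proof.
move=> th; apply/negP => tV; have /negP := no_half_turn h'; apply.
exact: (connect_trans (transl_sym th)).
Qed.

(** Frames over one vertex at heights of different parity would differ by a half-turn up to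
    translation, [V] itself being a translation here. *)
Let color i i' s s' : vx (G i s) = vx (G i' s') -> odd s -> odd s'.
Proof.
move=> E os; apply: contraT => es; exfalso.
have {os} [y ey] : exists y, s = y.*2.+1 by exists s./2; lia.
have {es} [y' ey'] : exists y', s' = y'.*2 by exists s'./2; lia.
move: E; rewrite {}ey {}ey' => E.
have := frame_fibre ns (G_frame _ _) (G_frame _ _) E.
rewrite G_even G_odd; set u := iter y b _; set v := iter y' b _ => uv.
have tu : transl f0 u by exact: transl_bN.
have tv : transl f0 v by exact: transl_bN.
have /negP := no_half tu; apply; case: uv => [ev|<-] //.
by rewrite -ev; apply: connect_trans V_f0 (transl_V tv).
Qed.

Let same_mod i i' s s' : i <= i' < m -> vx (G i s) = vx (G i' s') ->
  i = i' /\ s = s' %[mod h.*2].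
Proof.
case/andP=> li lm E; have odds : odd s = odd s'.
  by apply/idP/idP; [exact: color E | exact: color (esym E)].
have [r er] : exists r, i' = i + r by exists (i' - i); rewrite subnKC.
rewrite -(odd_double_half s) -(odd_double_half s') odds in E *.
set y := s./2 in E *; set y' := s'./2 in E *.
have key : iter y' b (iter i' N f0) = iter y b (iter i N f0) \/
   exists z, iter z b (iter i' N f0) = V (iter y b (iter i N f0)).
  case: (odd s') E => E.
    have := frame_fibre ns (G_frame _ _) (G_frame _ _) E; rewrite !add1n !G_odd.
    case=> [/(can_inj UK)|E2]; [by left | right; exists y'.+1].
    by transitivity (U (U (iter y' b (iter i' N f0)))); [|rewrite E2 UV UK].

  have := frame_fibre ns (G_frame _ _) (G_frame _ _) E; rewrite !add0n !G_even.
  by case=> E2; [left | right; exists y'].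
suff [r0 Ey] : r = 0 /\ y' = y %[mod h].
  split; first by rewrite er r0 addn0.
  have dbl x : x.*2 %% h.*2 = (x %% h).*2 by rewrite -!muln2 -muln_modl.
  by apply/eqP; rewrite eqn_modDl !dbl Ey.
have lr : r < m by lia.
case: key => [|[z]]; rewrite er.
  rewrite iterD iter_bN [RHS]iter_bN => /(iter_inj N_inj) E2.
  have r0 : r = 0.
    case: (posnP r) => // r0; have rm : 0 < r < m by rewrite r0.
    by have := no_cycle rm E2.
  by split=> //; apply: h_min; rewrite r0 in E2.
move=> /(congr1 (iter i b)); rewrite (iter_bN y i f0) -NV -iterD.
rewrite (iterD i r) iter_bN => /(iter_inj N_inj) E2.
case: (posnP r) => [r0|r0].
  by rewrite r0 in E2; case: (V_neq (esym E2)).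
by have := m_min r0 E2; lia.
Qed.

Let cover i s : exists i' s', i' < m /\ vx (G i s) = vx (G i' s').
Proof.
have [n] := ubnP i; elim: n i s => // n IH i s li.
have [lt|ge] := ltnP i m; first by exists i, s.
have [r er] : exists r, i = r + m by exists (i - m); rewrite subnK.
have lr : r < n by move: li; rewrite er; lia.
have [z ez] : exists z, iter s./2 b (iter i N f0) = V (iter z b (iter r N f0)).
  have [z ez] := bV_shift r (s./2 + r) j; exists z.
  by rewrite er iterD m_j NV -iterD -iter_bN.
have vxV g : vx (V g) = vx g by case: g => [[[[? ?] ?] ?] ?].
have [os|es] := boolP (odd s); last first.
  have [i' [s' [lt' E]]] := IH r z.*2 lr; exists i', s'; split=> //.
  by rewrite -E -[s in LHS](even_halfK es) !G_even ez vxV.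
have [i' [s' [lt' E]]] := IH r (z.*2 + h.*2).-1 lr; exists i', s'; split=> //.
rewrite -E -[s in LHS](odd_double_half s) os add1n G_odd ez UV vxV; congr vx.
apply: (can_inj UK); rewrite U'K -GU prednK ?G_per ?G_even //.
by rewrite addn_gt0 !double_gt0 h_gt0 orbT.
Qed.

(** The cycle goes down each column from height [a.*2] to [a.*2.+1] modulo [h.*2], then crosses to
    height [a.*2] of the next column. After [m] columns the glide closes it up if [j = a.*2]; for
    odd [j] the last column is followed upwards instead. *)
Let a := uphalf j.
Let turn i := (i == m.-1) && odd j.
Let ring_vertex k := let i := k %/ h.*2 in let t := k %% h.*2 in
  vx (G i (if turn i then a.*2 + t else a.*2 + h.*2 - t)).

Let ringE i t : t < h.*2 -> ring_vertex (i * h.*2 + t) =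
  vx (G i (if turn i then a.*2 + t else a.*2 + h.*2 - t)).
Proof.
by move=> lt; rewrite /ring_vertex divnMDl ?modnMDl ?double_gt0 // divn_small
  // addn0 modn_small.
Qed.

Let ring0 i : ring_vertex (i * h.*2) = vx (G i a.*2).
Proof.
have := @ringE i 0; rewrite addn0 => ->; last by rewrite double_gt0.
by case: ifP; rewrite ?addn0 ?subn0 ?G_per.
Qed.

Let edgeU i s : e (vx (G i s)) (vx (G i s.+1)) /\ e (vx (G i s.+1)) (vx (G i
  s)).
Proof. by rewrite GU vxU; case: (flagP (G i s)) => _ ee _ _; split;
  rewrite 1?[e (n2 _) _]e_sym. Qed.

Let h_gt1 : 1 < h.
Proof.
case: h h_gt0 h_per => [|[|]] // _;
  case: (f0) => [[[[x y] z] w] vf] /(congr1 vx).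
case/and5P: (vf) => ey ez ew yz /andP [yw zw]; rewrite /vx /= => E.
by have := ext_neq hex ey ez yz; rewrite E eqxx.
Qed.

Let G_mod i u v : u = v %[mod h.*2] -> G i u = G i v.
Proof.
have perM n s : G i (s + n * h.*2) = G i s.
  by elim: n => [|n IH]; rewrite ?addn0 // mulSn addnCA addnC G_per.
move=> E; rewrite (divn_eq u h.*2) (divn_eq v h.*2) E.
by rewrite ![_ * _ + _]addnC !perM.
Qed.

Let G_onto f : frame f0 f -> exists i s, f = G i s.
Proof.
move: f; apply: frame_ind; first by exists 0, 0.
  by move=> u [i [s ->]]; exists i, s.+1.
move=> u [i [s ->]]; case: (boolP (odd s)) => os.
  exists i.+1, s./2.*2; rewrite -G_X; congr X; congr G.
  by rewrite -[LHS]odd_double_half os.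
have [k ek] : exists k, G i s = G k.+1 s.
  exists (i + #|{: flag}|`!).-1.
  rewrite prednK ?addn_gt0 ?fact_gt0 ?orbT // /G iterD.
  by rewrite (iter_card_fact _ N_inj).
by exists k, s.+1; rewrite ek -(even_halfK os) -G_X XK.
Qed.

Let ring_onto x :
  exists i t, [/\ i < m, t < h.*2 & x = ring_vertex (i * h.*2 + t)].
Proof.
have d0 : 0 < h.*2 by rewrite double_gt0.
have [f [Ff <-]] := frame_onto f0 x.
have [i0 [s0 ->]] := G_onto Ff.
have [i [s [li ->]]] := cover i0 s0.
exists i; case tu: (turn i).
  exists ((s + h.*2.-1 * a.*2) %% h.*2); split; rewrite ?ltn_mod //.
  rewrite ringE ?ltn_mod // tu; congr vx; apply: G_mod.
  by rewrite modnDmr addnCA -mulSn prednK // addnC mulnC modnMDl.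
exists ((a.*2 + h.*2.-1 * s) %% h.*2); split; rewrite ?ltn_mod //.
rewrite ringE ?ltn_mod // tu; congr vx; apply: G_mod.
set t := (a.*2 + _) %% _; have lt : t < h.*2 by rewrite ltn_mod.
apply/eqP; rewrite -(eqn_modDr t).
have -> : a.*2 + h.*2 - t + t = a.*2 + h.*2 by lia.
by rewrite /t modnDmr addnCA -mulSn prednK // modnDr mulnC addnC modnMDl.
Qed.

Let ring_inj : {in gtn (m * h.*2) &, injective ring_vertex}.
Proof.
have d0 : 0 < h.*2 by rewrite double_gt0.
have same i i' s s' : i < m -> i' < m -> vx (G i s) = vx (G i' s') ->
    i = i' /\ s = s' %[mod h.*2].
  move=> li li' E; case/orP: (leq_total i i') => le.
    by apply: same_mod E; rewrite le.
  by have [|-> ->] := same_mod _ (esym E); rewrite ?le.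
move=> k k'; rewrite !inE -!ltn_divLR // => lk lk' /(same _ _ _ _ lk lk') [Ei].
rewrite -Ei => Et; rewrite (divn_eq k h.*2) (divn_eq k' h.*2) Ei; congr (_ + _).
have := ltn_pmod k d0; have := ltn_pmod k' d0; move: Et.
move: (k %% h.*2) (k' %% h.*2) => t t'; case: ifP => _ /eqP E lt' lt.
  by move: E; rewrite eqn_modDl !modn_small // => /eqP.
move: E; rewrite -(eqn_modDr (t + t')).
have -> : a.*2 + h.*2 - t + (t + t') = a.*2 + h.*2 + t' by lia.
have -> : a.*2 + h.*2 - t' + (t + t') = a.*2 + h.*2 + t by lia.
by rewrite eqn_modDl !modn_small // => /eqP.
Qed.

Lemma hamiltonian_of_reflected : exists c, hamiltonian_cycle e c.
Proof.
have d0 : 0 < h.*2 by rewrite double_gt0.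
exists (mkseq ring_vertex (m * h.*2)).
split; last first.
  move=> x; have [i [t [li lt ->]]] := ring_onto x.
  by apply/mapP; exists (i * h.*2 + t) => //; rewrite mem_iota /=; nia.
split; last by rewrite size_mkseq; nia.
apply/andP; split; last exact/mkseq_uniqP/ring_inj.
have edgeX g : e (vx g) (vx (X g)) by rewrite vxX; case: (flagP g).
apply: cycle_mkseq => [k lk|].
  rewrite (divn_eq k h.*2); move: (ltn_pmod k d0) (divn_eq k h.*2) lk.
  move: (k %/ h.*2) (k %% h.*2) => i t lt -> lk.
  rewrite ringE //; have [lt1|ge1] := ltnP t.+1 h.*2.
    rewrite -addnS ringE //; case: ifP => _; first by rewrite addnS;
      case: (edgeU i (a.*2 + t)).
    have -> : a.*2 + h.*2 - t = (a.*2 + h.*2 - t.+1).+1 by lia.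
    by case: (edgeU i (a.*2 + h.*2 - t.+1)).
  have et : t.+1 = h.*2 by lia.
  have -> : (i * h.*2 + t).+1 = i.+1 * h.*2 by rewrite -addnS et mulSnr.
  have ti : turn i = false.
    by rewrite /turn; case: eqP => // ei; move: lk; rewrite ei; nia.
  have -> : a.*2 + h.*2 - t = a.*2.+1 by lia.
  by rewrite ti ring0 -G_X.
have -> : (m * h.*2).-1 = m.-1 * h.*2 + h.*2.-1 by nia.
have := ring0 0; rewrite mul0n => ->; rewrite ringE ?prednK // {1}/turn eqxx /=.
have -> : vx (G 0 a.*2) = vx (V (iter a b f0)).
  by rewrite G_even; case: (iter a b f0) => [[[[? ?] ?] ?] ?].
case: (boolP (odd j)) => oj.
  have -> : a.*2 + h.*2.-1 = (a + h.-1).*2.+1 by lia.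
  have -> : V (iter a b f0) = X (G m.-1 (a + h.-1).*2.+1) => //.
  rewrite G_X prednK // G_even m_j.
  have -> : iter j b f0 = iter (a + h.-1) b (iter a b f0).
    rewrite -iterD (_ : a + h.-1 + a = j + h) ?iterD ?h_per //.
    by rewrite /a; lia.
  by rewrite bVb.
have -> : a.*2 + h.*2 - h.*2.-1 = a.*2.+1 by lia.
have -> : V (iter a b f0) = X (G m.-1 a.*2.+1) => //.
rewrite G_X prednK // G_even m_j.
have -> : iter j b f0 = iter a b (iter a b f0).
  by rewrite -iterD; congr iter; rewrite /a; lia.
by rewrite bVb.
Qed.

End Reflected.

Lemma hamiltonian_of_reflection f0 : no_slant f0 -> frame f0 (V f0) ->
  exists c, hamiltonian_cycle e c.
Proof.
move=> ns /frame_transl tV.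
have {}tV : transl f0 (V f0).
  case: tV => //; rewrite -VUV VK => tT.
  by have /negP := no_half_turn f0.
pose h := order b f0.
have h_gt0 : 0 < h by exact: order_gt0.
have h_per : iter h b f0 = f0 by exact: iter_order.
have iter_mod t : iter t b f0 = iter (t %% h) b f0.
  rewrite {1}(divn_eq t h) addnC iterD iterM; congr iter.
  by elim: (t %/ h) => //= n ->.
pose reflected i := [exists s : 'I_h, iter i N f0 == V (iter s b f0)].
have reflectedP i s t : iter s b (iter i N f0) = V (iter t b f0) -> reflected i.
  rewrite -(bVb s) => /(iter_inj b_inj) E; apply/existsP.
  exists (Ordinal (ltn_pmod (s + t) h_gt0)).
  by rewrite /= -iter_mod E iterD.
have ex_m : exists i, (0 < i) && reflected i.
  have [i [y E]] := translE tV; exists (i + #|{: flag}|`!).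
  rewrite addn_gt0 fact_gt0 orbT; apply: (reflectedP _ y 0).
  by rewrite iterD (iter_card_fact _ N_inj).
case: (ex_minnP ex_m) => m /andP [m_gt0 /existsP [j /eqP m_j]] mmin.
apply: (hamiltonian_of_reflected ns h_gt0 h_per _ tV m_gt0 m_j).
  by move=> y z; apply: iter_eq_order_dvdn.
by move=> i s t i0 /reflectedP ri; apply: mmin; rewrite i0.
Qed.

Lemma hamiltonian_of_hexagonal : exists c, hamiltonian_cycle e c.
Proof.
have [/card_gt0P [x _] _] := e_conn.
have /card_gt0P [y] : 0 < #|[set y | e x y]| by rewrite e_cubic.
have := e_cubic x; rewrite (cardsD1 y) inE => E ey; move: E;
  rewrite ey => -[] /eqP.
case/cards2P=> [z [w [zw Ezw]]].
have /setD1P [zy] : z \in [set a | e x a] :\ y by rewrite Ezw !inE eqxx.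
have /setD1P [wy] : w \in [set a | e x a] :\ y by rewrite Ezw !inE eqxx orbT.
rewrite !inE => ew ez.
have vf : is_flag (x, y, z, w) by rewrite /= ey ez ew zw !(eq_sym y) zy wy.
have [f0 ns] := ex_no_slant (exist is_flag (x, y, z, w) vf).
have [refl|] := boolP (frame f0 (V f0));
  first exact: hamiltonian_of_reflection ns refl.
exact: hamiltonian_of_section.
Qed.

End Flags.

End FlagCalculus.

(** * From the cycle double cover to the hexagonal surface *)

Section Faces.

Variables (T : finType) (e : rel T) (C : seq (seq T)).
Hypotheses (e_sym : symmetric e) (e_cubic : cubic_graph e).
Hypothesis cdc : six_cycle_double_cover e C.

Let face_cycle c : c \in C -> ucycle e c /\ size c = 6.
Proof. by case: cdc => [[gc _] s6] cC; have [uc _] := gc _ cC; rewrite s6. Qed.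

(** Both orientations are kept, so that a corner can be traversed in either direction. *)
Let faces := C ++ map rev C.

Let facesP c : c \in faces -> [/\ cycle e c, uniq c & size c = 6].
Proof.
rewrite mem_cat => /orP [/face_cycle [/andP [cc uc] sc] //|].
case/mapP=> c' /face_cycle [/andP [cc uc] sc] ->.
rewrite rev_uniq size_rev; split=> //; rewrite rev_cycle.
by rewrite (eq_cycle (e' := e)) // => u v; rewrite e_sym.
Qed.

Let faces_rev c : c \in faces -> rev c \in faces.
Proof.
rewrite !mem_cat => /orP [cC|/mapP [c' cC ->]]; last by rewrite revK cC.
by rewrite map_f ?orbT.
Qed.

Let face_hexagon c y : c \in faces -> y \in c -> exists x z t u v,
  [/\ uniq [:: y; x; z; t; u; v], [/\ next c y = x, next c x = z & next c z = t]
    & [/\ next c t = u, next c u = v & next c v = y]].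
Proof.
move=> /facesP [cc uc sc] /rot_to [i s E].
have : size (y :: s) = 6 by rewrite -E size_rot.
have us : uniq (y :: s) by rewrite -E rot_uniq.
have nE : next c =1 next (y :: s) by move=> x; rewrite -E next_rot.
case: s us nE {E} => [|x [|z [|t [|u [|v []]]]]] //= us nE _.
have us' : uniq [:: y; x; z; t; u; v] by [].
have rotE n : next c =1 next (rot n [:: y; x; z; t; u; v]).
  by move=> a; rewrite next_rot // nE.
exists x, z, t, u, v; split=> //; split.
- by rewrite (rotE 0) /= eqxx.
- by rewrite (rotE 1) /= eqxx.
- by rewrite (rotE 2) /= eqxx.
- by rewrite (rotE 3) /= eqxx.
- by rewrite (rotE 4) /= eqxx.
- by rewrite (rotE 5) /= eqxx.
Qed.

Let corner (x y z : T) (c : seq T) := (x \in c) &&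
  ((prev c x == y) && (next c x == z) || (prev c x == z) && (next c x == y)).

Let sides c x : c \in C -> x \in c ->
  [/\ e x (next c x), e x (prev c x) & prev c x != next c x].
Proof.
move=> cC xc; have cF : c \in faces by rewrite mem_cat cC.
have [cc uc _] := facesP cF.
split; first exact: next_cycle.
  by rewrite e_sym; exact: prev_cycle.
have [x1 [x2 [x3 [x4 [x5 [U6 [E1 _ _] [_ _ E6]]]]]]] := face_hexagon cF xc.
rewrite E1 -{1}E6 prev_next //; apply: contraTneq U6 => ->.
by rewrite /= !inE eqxx !orbT /= andbF.
Qed.

Let third x y z : e x y -> e x z -> y != z -> exists w,
  [/\ e x w, y != w, z != w & forall a, e x a -> [\/ a = y, a = z | a = w]].
Proof.
move=> ey ez yz; have := e_cubic x.
rewrite (cardsD1 y) (cardsD1 z) !inE ey ez (eq_sym z) yz /= => -[] /eqP.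
case/cards1P => w Ew.
have : w \in [set a | e x a] :\ y :\ z by rewrite Ew inE.
rewrite !inE => /and3P [wz wy ew]; exists w; split; rewrite 1?eq_sym // => a ea.
have [-> | ay] := eqVneq a y; first by constructor 1.
have [-> | az] := eqVneq a z; first by constructor 2.
constructor 3; apply/eqP; have : a \in [set a | e x a] :\ y :\ z by rewrite
  !inE az ay ea.
by rewrite Ew inE.
Qed.

Let edge_corner x y z w c : c \in C -> e x y -> e x z -> e x w ->
  y != z -> y != w -> z != w -> (forall a, e x a ->
    [\/ a = y, a = z | a = w]) ->
  edge_of_cycle x y c = corner x y z c || corner x y w c /\
    corner x y z c && corner x y w c = false.
Proof.
move=> cC ey ez ew yz yw zw nb; rewrite /edge_of_cycle /corner.
case xc: (x \in c) => //=.
have cF : c \in faces by rewrite mem_cat cC.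
have [_ uc _] := facesP cF.
have -> : (y \in c) && ((next c x == y) || (next c y == x))
    = (next c x == y) || (prev c x == y).
  apply/andP/orP => [[yc /orP [->|/eqP <-]]|[/eqP <-|/eqP <-]]; [by left | | |].
  - by right; rewrite prev_next.
  - by rewrite mem_next xc eqxx.
  - by rewrite mem_prev xc next_prev // eqxx orbT.
have [/nb n1 /nb n2] := sides cC xc.
move: n1 n2; move: (next c x) (prev c x) => n p n1 n2.
have F := (negPf yz, negPf yw, negPf zw).
have F' : (z == y = false) * (w == y = false) * (w == z = false).
  by rewrite !(eq_sym _ y) (eq_sym w) !F.
by case: n1 => ->; case: n2 => ->; rewrite ?eqxx ?F ?F' //= ?F ?F'.
Qed.

(** An edge at [x] lies on a cycle through exactly one of its two corners there. So the counts of
    the three corners at [x] add up to 2 in pairs, and each is 1. *)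
Let count_corner x y z : e x y -> e x z -> y != z -> count (corner x y z) C = 1.
Proof.
move=> ey ez yz; have [w [ew yw zw nb]] := third ey ez yz.
have [[_ two] _] := cdc.
have add a b c : e x a -> e x b -> e x c -> a != b -> a != c -> b != c ->
    (forall a', e x a' -> [\/ a' = a, a' = b | a' = c]) ->
    count (corner x a b) C + count (corner x a c) C = 2.
  move=> ea eb ec ab ac bc nbs; rewrite -(two _ _ ea) -count_predUI.
  rewrite [X in _ + X](_ : _ = 0) ?addn0.
    apply: eq_in_count => d dC /=.
    by have [-> _] := edge_corner dC ea eb ec ab ac bc nbs.
  apply/eqP; rewrite -leqn0 leqNgt -has_count -all_predC; apply/allP => d dC /=.
  by have [_ ->] := edge_corner dC ea eb ec ab ac bc nbs.
have cs a b : count (corner x a b) C = count (corner x b a) C.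
  by apply: eq_count => d; rewrite /corner orbC.
have zy : z != y by rewrite eq_sym.
have wy : w != y by rewrite eq_sym.
have wz : w != z by rewrite eq_sym.
have H1 := add y z w ey ez ew yz yw zw nb.
have H2 := add z y w ez ey ew zy zw yw _.
have H3 := add w y z ew ey ez wy wz yz _.
have {}H2 : count (corner x z y) C + count (corner x z w) C = 2.
  by apply: H2 => a /nb []; [constructor 2 | constructor 1 | constructor 3].
have {}H3 : count (corner x w y) C + count (corner x w z) C = 2.
  by apply: H3 => a /nb []; [constructor 2 | constructor 3 | constructor 1].
move: H1 H2 H3; rewrite (cs z y) (cs w y) (cs w z); lia.
Qed.

Let follows (y x z : T) (c : seq T) := [&& y \in c,
  next c y == x & next c x == z].

Let follows_rev y x z c : c \in faces -> follows y x z c ->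
  follows z x y (rev c).
Proof.
move=> /facesP [_ uc _] /and3P [yc /eqP <- /eqP <-].
by rewrite /follows mem_rev !next_rev // !mem_next yc !prev_next // !eqxx.
Qed.

Let follows_corner y x z c : c \in faces -> follows y x z c ->
  exists2 c0, c0 \in C & corner x y z c0 /\ (c = c0 \/ c = rev c0).
Proof.
move=> cF f; have cor c' : c' \in faces -> follows y x z c' ->
    (x \in c') && ((prev c' x == y) && (next c' x == z)).
  move=> /facesP [_ uc _] /and3P [yc /eqP <- /eqP <-].
  by rewrite mem_next yc prev_next // !eqxx.
move: (cF); rewrite mem_cat => /orP [cC|/mapP [c0 cC ec]].
  by exists c => //; split; [rewrite /corner andb_orr cor | left].
exists c0 => //; split; last by right.
have uc0 : uniq c0 by have := facesP cF; rewrite ec rev_uniq => -[].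
have := cor _ cF f; rewrite ec mem_rev prev_rev // next_rev // /corner.
by case/and3P=> -> -> ->; rewrite orbT.
Qed.

(** [count_corner] determines the cycle, and [y != z] its orientation. *)
Let follows_uniq y x z c c' : e x y -> e x z -> y != z ->
  c \in faces -> c' \in faces -> follows y x z c -> follows y x z c' -> c = c'.
Proof.
move=> ey ez yz cF cF' f f'.
have [c0 c0C [k0 e0]] := follows_corner cF f.
have [c1 c1C [k1 e1]] := follows_corner cF' f'.
have E : c0 = c1.
  have : size (filter (corner x y z) C) = 1 by rewrite size_filter count_corner.
  have : c0 \in filter (corner x y z) C by rewrite mem_filter k0.
  have : c1 \in filter (corner x y z) C by rewrite mem_filter k1.
  by case: filter => [|a []] //; rewrite !inE => /eqP -> /eqP ->.
have absurd d : d \in faces -> follows y x z d -> follows y x z (rev d) ->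
  False.
  move=> dF /and3P [yd /eqP n1 /eqP n2] /and3P [_ _ /eqP].
  have [_ ud _] := facesP dF; rewrite next_rev // -n1 prev_next // => E2.
  by rewrite E2 eqxx in yz.
rewrite -E in e1; case: e0 => e0; case: e1 => e1; rewrite ?e0 ?e1 //.
  by case: (absurd c cF f); rewrite e0 -e1.
by case: (absurd c' cF' f'); rewrite e1 -e0.
Qed.

Let follows_ex y x z : e x y -> e x z -> y != z ->
  exists2 c, c \in faces & follows y x z c.
Proof.
move=> ey ez yz; have : has (corner x y z) C by rewrite has_count count_corner.
case/hasP=> c cC /andP [xc k]; have cF : c \in faces by rewrite mem_cat cC.
have [_ uc _] := facesP cF.
have mk a b : (prev c x == a) && (next c x == b) -> follows a x b c.
  by case/andP=> /eqP <- nb; rewrite /follows mem_prev xc next_prev // eqxx.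
case/orP: k => /mk f; first by exists c.
by exists (rev c); [exact: faces_rev | exact: follows_rev].
Qed.

Let ext y x z := head x [seq next c z | c <- faces & follows y x z c].

Let extE y x z c : e x y -> e x z -> y != z -> c \in faces -> follows y x z c ->
  ext y x z = next c z.
Proof.
move=> ey ez yz cF f; rewrite /ext.
have : all (fun d => next d z == next c z) (filter (follows y x z) faces).
  apply/allP => d; rewrite mem_filter => /andP [fd dF].
  by rewrite (follows_uniq ey ez yz dF cF fd f).
have : c \in filter (follows y x z) faces by rewrite mem_filter f.
by case: filter => //= d s _ /andP [/eqP].
Qed.

Lemma hexagonal_of_cdc : exists ext, hexagonal e ext.
Proof.
have key y x z : e x y -> e x z -> y != z -> exists t u v,
  [/\ uniq [:: y; x; z; t; u; v],
      [/\ ext y x z = t, ext x z t = u & ext z t u = v],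
      [/\ ext t z x = y, ext z x y = v, ext x y v = u & ext y v u = t] & e z t].
  move=> ey ez yz; have [c cF /and3P [yc /eqP n1 /eqP n2]] := follows_ex ey ez
    yz.
  have [x' [z' [t [u [v [U6 [E1 E2 E3] [E4 E5 E6]]]]]]] := face_hexagon cF yc.
  rewrite n1 in E1; rewrite -{}E1 n2 in U6 E2; rewrite -{}E2 in U6 E3.
  have [cc uc _] := facesP cF.
  have mx : x \in c by rewrite -n1 mem_next.
  have mz : z \in c by rewrite -n2 mem_next.
  have mt : t \in c by rewrite -E3 mem_next.
  have mu : u \in c by rewrite -E4 mem_next.
  have mv : v \in c by rewrite -E5 mem_next.
  have ed a b : a \in c -> next c a = b -> e a b /\ e b a.
    by move=> ac <-; rewrite (e_sym _ a) next_cycle.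
  have [eyx exy] := ed _ _ yc n1; have [exz ezx] := ed _ _ mx n2.
  have [ezt etz] := ed _ _ mz E3; have [etu eut] := ed _ _ mt E4.
  have [euv evu] := ed _ _ mu E5; have [evy eyv] := ed _ _ mv E6.
  have fw a b d : a \in c -> next c a = b -> next c b = d -> follows a b d c.
    by move=> ac E E'; rewrite /follows ac E E' !eqxx.
  have bw a b d : a \in c -> next c a = b -> next c b = d ->
    follows d b a (rev c).
    by move=> ac E E'; apply: follows_rev => //; exact: fw.
  have rF := faces_rev cF.
  have pv a b : next c a = b -> next (rev c) b = a.
    by move=> <-; rewrite next_rev // prev_next.
  move: (U6); rewrite /= !inE !negb_or !andbT.
  case/and5P=> /and5P[yx _ yt yu yv] /and4P[xz' xt xu xv] /and3P[zt zu zv]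
    /andP[tu tv] uv.
  exists t, u, v; split=> //; split.
  - by rewrite (@extE y x z c) // fw.
  - by rewrite (@extE x z t c) // fw.
  - by rewrite (@extE z t u c) // fw.
  - rewrite (@extE t z x (rev c)) 1?eq_sym //; [exact: pv | exact: bw].
  - rewrite (@extE z x y (rev c)) 1?eq_sym //; [exact: pv | exact: bw].
  - rewrite (@extE x y v (rev c)) //; [exact: pv | exact: bw].
  - rewrite (@extE y v u (rev c)) //; [exact: pv | exact: bw].
exists ext; split=> y x z ey ez yz;
  have [t [u [v [U6 [E1 E2 E3] [F1 F2 F3 F4] ezt]]]] := key _ _ _ ey ez yz.
- by rewrite E1.
- rewrite E1; apply: contraTneq U6 => ->; rewrite /= !inE eqxx !orbT /=.
  by rewrite !andbF.
- by rewrite E1.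
by rewrite /= E1 E2 E3.
Qed.

End Faces.

Theorem mainTheorem1 (T : finType) (e : rel T)
    (hsimple : simple_graph e) (hconn : connected_graph e)
    (hcubic : cubic_graph e)
    (hcdc : exists C : seq (seq T), six_cycle_double_cover e C) :
  exists c : seq T, hamiltonian_cycle e c.
Proof.
have [e_sym e_irr] := hsimple; have [C cdc] := hcdc.
have [ext hex] := hexagonal_of_cdc e_sym hcubic cdc.
exact: (FlagCalculus.hamiltonian_of_hexagonal e_sym e_irr hcubic hex hconn).
Qed.
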